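(* The following statements are true. (i) Let $B\in\mathrm{GL}(n,\mathbb{R})$ be any matrix with $|\det B|>1$. Then the pair $(B,\Gamma)$ satisfies the lattice counting estimate for almost all lattices $\Gamma\in\mathcal{L}_n$ in the sense of the invariant measure $\mu_{\mathcal{L}}$. (ii) Let $\Gamma\subset\mathbb{R}^n$ be any full-rank lattice. Then the pair $(B,\Gamma)$ satisfies the lattice counting estimate for almost every $B\in\mathrm{GL}(n,\mathbb{R})$ with $|\det B|>1$ (with respect to the Haar measure on $\mathrm{GL}(n,\mathbb{R})$).
   Context: Lattice counting estimate: for an invertible $n\times n$ real matrix $B$ with $|\det B|>1$ and a full-rank lattice $\Gamma\subset\mathbb{R}^n$, the pair $(B,\Gamma)$ satisfies the lattice counting estimate if, for $r>0$, there is a constant $C=C(r)$ such that $\#\big(\Gamma\cap B^j(\mathbf{B}(0,r))\big)\le C\max(1,|\det B|^j)$ for all $j\in\mathbb{Z}$, where $\mathbf{B}(0,r)$ is the open ball of radius $r$ centered at $0$. The validity of this for some $r>0$ is equivalent to its validity for every $r>0$. $\mathcal{L}_n$ is the set of unimodular lattices in $\mathbb{R}^n$ (full-rank lattices of covolume $1$), identified with $\mathrm{SL}(n,\mathbb{R})/\mathrm{SL}(n,\mathbb{Z})$ via $P\mapsto P\mathbb{Z}^n$, and $\mu_{\mathcal{L}}$ is the $\mathrm{SL}(n,\mathbb{R})$-invariant probability measure on $\mathcal{L}_n$. *)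

(* Defs.v *)
From HB Require Import structures.
From mathcomp Require Import all_boot all_order all_algebra.
From mathcomp Require Import finmap.
From mathcomp Require Import all_classical all_reals all_analysis.
Set Implicit Arguments.
Unset Strict Implicit.
Unset Printing Implicit Defensive.
Import Order.TTheory GRing.Theory Num.Theory.
Import numFieldNormedType.Exports.
Local Open Scope classical_set_scope.
Local Open Scope ring_scope.

(* Matrices are of size n.+1: the dimension is at least 1, so that 'M[R]_n.+1
   is a unit ring and B ^ j makes sense for j : int. *)

Definition enorm (R : realType) (n : nat) (x : 'cV[R]_n.+1) : R :=
  Num.sqrt (\sum_i x i 0 ^+ 2).

(* The library's [ball] on matrices is the one of the sup norm. *)
Definition eball (R : realType) (n : nat) (r : R) : set 'cV[R]_n.+1 :=
  [set x | enorm x < r].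

Definition lattice_of (R : realType) (n : nat) (P : 'M[R]_n.+1) :
    set 'cV[R]_n.+1 :=
  [set P *m map_mx intr z | z in [set: 'cV[int]_n.+1]].

Definition full_rank_lattice (R : realType) (n : nat) (G : set 'cV[R]_n.+1) :=
  exists2 P : 'M[R]_n.+1, P \in unitmx & G = lattice_of P.

(* The covolume of [lattice_of P] is `|\det P|, whatever the basis P. *)
Definition unimodular_lattice (R : realType) (n : nat) (G : set 'cV[R]_n.+1) :=
  exists P : 'M[R]_n.+1,
    [/\ P \in unitmx, G = lattice_of P & `|\det P| = 1].

(* [fset_set] sends infinite sets to the empty set, whence the explicit
   finiteness requirement. *)
Definition lattice_counting_estimate (R : realType) (n : nat)
    (B : 'M[R]_n.+1) (G : set 'cV[R]_n.+1) :=
  forall r : R, 0 < r -> exists C : R, forall j : int,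
    let S := G `&` [set B ^ j *m x | x in eball r] in
    finite_set S /\ #|` fset_set S|%:R <= C * Num.max 1 (`|\det B| ^ j).

Definition borel (T : ptopologicalType) := g_sigma_algebraType (@open T).

HB.instance Definition _ (T : ptopologicalType) :=
  Measurable.on (borel T).

(* GL(n, R), with the topology induced by that of the matrices. *)
Definition GL (R : realType) (n : nat) :=
  set_type [set P : 'M[R]_n.+1 | P \in unitmx].

HB.instance Definition _ (R : realType) (n : nat) :=
  Topological.on (GL R n).

HB.instance Definition _ (R : realType) (n : nat) :=
  isPointed.Build (GL R n) (exist _ 1%:M (mem_set (unitmx1 R n.+1))).

Lemma GL_mul_subproof (R : realType) (n : nat) (g h : GL R n) :
  \val g *m \val h \in [set P : 'M[R]_n.+1 | P \in unitmx].
Proof.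
by apply: mem_set; rewrite /= unitmx_mul; apply/andP; split;
  [exact: (set_mem (valP g))|exact: (set_mem (valP h))].
Qed.

Definition GL_mul (R : realType) (n : nat) (g h : GL R n) : GL R n :=
  exist _ (\val g *m \val h) (GL_mul_subproof g h).

(* Since GL(n, R) is locally compact and second countable, such a Borel measure
   is automatically regular; it is unique up to a positive factor. As GL(n, R)
   is unimodular, left and right Haar measures coincide. The preimage of A
   under x |-> g x is the translate of A by the inverse of g. *)
Definition haar_measure (R : realType) (n : nat)
    (mu : {measure set (borel (GL R n)) -> \bar R}) :=
  [/\ mu setT != 0%E,
      forall K : set (GL R n), compact K -> (mu K < +oo)%E &
      forall (g : GL R n) (A : set (borel (GL R n))), measurable A ->
        mu (GL_mul g @^-1` A) = mu A].

Definition SL (R : realType) (n : nat) :=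
  set_type [set P : 'M[R]_n.+1 | \det P = 1].

HB.instance Definition _ (R : realType) (n : nat) :=
  Topological.on (SL R n).

Definition Ln (R : realType) (n : nat) :=
  set_type [set G : set 'cV[R]_n.+1 | unimodular_lattice G].

HB.instance Definition _ (R : realType) (n : nat) := Choice.on (Ln R n).

Lemma SL_lattice_subproof (R : realType) (n : nat) (P : SL R n) :
  lattice_of (\val P) \in
    [set G : set 'cV[R]_n.+1 | unimodular_lattice G].
Proof.
have detP : \det (\val P) = 1 by exact: (set_mem (valP P)).
apply: mem_set; exists (\val P); split=> //; last by rewrite detP normr1.
by rewrite unitmxE detP unitr1.
Qed.

Definition SL_lattice (R : realType) (n : nat) (P : SL R n) : Ln R n :=
  exist _ (lattice_of (\val P)) (SL_lattice_subproof P).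

(* The topology of L_n is the quotient topology of SL(n, R)/SL(n, Z), i.e. the
   final topology for the map P |-> P Z^n. *)
Definition Ln_open (R : realType) (n : nat) (U : set (Ln R n)) :=
  open (@SL_lattice R n @^-1` U).

Lemma Ln_openT (R : realType) (n : nat) : Ln_open [set: Ln R n].
Proof. by rewrite /Ln_open preimage_setT; exact: openT. Qed.

Lemma Ln_openI (R : realType) (n : nat) (U V : set (Ln R n)) :
  Ln_open U -> Ln_open V -> Ln_open (U `&` V).
Proof. exact: openI. Qed.

Lemma Ln_open_bigU (R : realType) (n : nat) (I : Type)
    (f : I -> set (Ln R n)) :
  (forall i, Ln_open (f i)) -> Ln_open (\bigcup_i f i).
Proof. by move=> of_; apply: bigcup_open => i _; exact: of_. Qed.

HB.instance Definition _ (R : realType) (n : nat) :=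
  isOpenTopological.Build (Ln R n)
    (@Ln_openT R n) (@Ln_openI R n) (@Ln_open_bigU R n).

HB.instance Definition _ (R : realType) (n : nat) :=
  isPointed.Build (Ln R n) (SL_lattice (exist _ 1%:M (mem_set (det1 R n.+1)))).

Lemma Ln_act_subproof (R : realType) (n : nat) (g : SL R n) (G : Ln R n) :
  [set \val g *m x | x in \val G] \in
    [set G : set 'cV[R]_n.+1 | unimodular_lattice G].
Proof.
have detg : \det (\val g) = 1 by exact: (set_mem (valP g)).
have [P [uP GP detP]] : unimodular_lattice (\val G)
  by exact: (set_mem (valP G)).
apply: mem_set; exists (\val g *m P); split.
- by rewrite unitmx_mul uP andbT unitmxE detg unitr1.
- rewrite GP /lattice_of image_comp; congr (_ @` _).
  by apply/funext => z /=; rewrite mulmxA.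
- by rewrite det_mulmx detg mul1r.
Qed.

Definition Ln_act (R : realType) (n : nat) (g : SL R n) (G : Ln R n) : Ln R n :=
  exist _ [set \val g *m x | x in \val G] (Ln_act_subproof g G).

(* There is exactly one SL(n, R)-invariant Borel probability measure on L_n. *)
Definition SL_invariant (R : realType) (n : nat)
    (mu : probability (borel (Ln R n)) R) :=
  forall (g : SL R n) (A : set (borel (Ln R n))), measurable A ->
    mu (Ln_act g @^-1` A) = mu A.

(* Main.v *)
Require Import Defs.
From HB Require Import structures.
From mathcomp Require Import all_boot all_order all_algebra.
From mathcomp Require Import perm.
From mathcomp Require Import finmap.
From mathcomp Require Import ring lra zify.
From mathcomp Require Import all_classical all_reals all_analysis.
From mathcomp Require Import measurable_realfun.
Set Implicit Arguments.
Unset Strict Implicit.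
Unset Printing Implicit Defensive.
Import Order.TTheory GRing.Theory Num.Theory.
Import numFieldNormedType.Exports.
Local Open Scope classical_set_scope.
Local Open Scope ring_scope.

(** The points of G in the image of a ball under B ^ j correspond to the short
    vectors of the lattice B ^ (-j) G. By transference ([posdef_dual_count]) their
    number is at most a constant over the covolume, that is a constant times
    |det B| ^ j, as soon as the dual lattice has no nonzero vector shorter than 1,
    and this dual is the image of the dual of G under the j-th power of the
    transpose of B. For negative j the count is 1 as soon as B ^ |j| G has no
    nonzero vector shorter than the radius. Hence the estimate holds
    ([counting_of_escapes]) if G under B and its dual under the transpose of B
    both escape: for large j no nonzero vector of the j-th image lies in a given
    ball.

    Almost every lattice escapes by a first moment bound and Borel-Cantelli
    ([ae_escapes]). The first moment comes from a packing argument instead of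
    Siegel's mean value formula. The vectors y of size X with |B ^ j y| < r form a
    thin set, and there are about |det B| ^ j (X / r) ^ d bounded shears, d being
    the dimension, whose preimages of the thin set are disjoint
    ([shear_packing]). Shears preserve the measure, and a lattice with a bounded
    basis has O(X ^ d) vectors of size X. So the lattices that meet the thin set
    have measure O(|det B| ^ (-j)), uniformly in X ([thin_shell_measure]). Only
    O(j) dyadic values of X occur, and the sum over j converges.

    The argument needs an action of SL that is compatible with duality
    ([unimodular_action]). On the space of unimodular lattices it gives the first
    part. On GL with its Haar measure, with the lattice g G attached to g, it
    says that for each B with |det B| > 1 almost every conjugate g ^ (-1) B g
    satisfies the estimate for G. Fubini's theorem and left invariance convert
    this into the statement that almost every B does ([haar_ae_good_pair]). *)


(** * Quadratic forms and Schur complements *)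

Definition qf (R : realType) (m : nat) (S : 'M[R]_m) (x : 'cV[R]_m) : R :=
  (x^T *m S *m x) 0 0.

Definition posdef (R : realType) (m : nat) (S : 'M[R]_m) : Prop :=
  S^T = S /\ forall x, x != 0 -> 0 < qf S x.

Lemma qf_gram (R : realType) (m p : nat) (A : 'M[R]_(p, m)) (x : 'cV[R]_m) :
  qf (A^T *m A) x = \sum_i ((A *m x) i 0) ^+ 2.
Proof.
rewrite /qf mulmxA -trmx_mul -mulmxA mxE.
by apply: eq_bigr => i _; rewrite mxE expr2.
Qed.

Lemma sum_sqr_eq0 (R : realType) (m : nat) (x : 'cV[R]_m) :
  \sum_i (x i 0) ^+ 2 = 0 -> x = 0.
Proof.
move=> /eqP; rewrite psumr_eq0 => [/allP x0|i _]; last exact: sqr_ge0.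
apply/colP => i; rewrite mxE; apply/eqP.
by rewrite -sqrf_eq0; apply: x0; rewrite mem_index_enum.
Qed.

Lemma posdef_gram (R : realType) (m : nat) (A : 'M[R]_m) :
  A \in unitmx -> posdef (A^T *m A).
Proof.
move=> uA; split; first by rewrite trmx_mul trmxK.
move=> x x0; rewrite qf_gram lt_neqAle sumr_ge0 ?andbT => [|i _]; last first.
  exact: sqr_ge0.
rewrite eq_sym; apply: contraNneq x0 => /sum_sqr_eq0 Ax0.
by rewrite -(mulKmx uA x) Ax0 mulmx0.
Qed.

Lemma qf_congr (R : realType) (m p : nat) (S : 'M[R]_p) (U : 'M[R]_(p, m)) x :
  qf (U^T *m S *m U) x = qf S (U *m x).
Proof. by rewrite /qf trmx_mul !mulmxA. Qed.

Lemma qfZ (R : realType) (m : nat) (S : 'M[R]_m) (k : R) x :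
  qf S (k *: x) = k ^+ 2 * qf S x.
Proof.
by rewrite /qf [(_ *: _)^T]linearZ /= -!scalemxAl -scalemxAr scalerA mxE.
Qed.

Lemma posdef_congr (R : realType) (m : nat) (S U : 'M[R]_m) :
  U \in unitmx -> posdef S -> posdef (U^T *m S *m U).
Proof.
move=> uU [symS S0]; split; first by rewrite !trmx_mul trmxK symS mulmxA.
move=> x x0; rewrite qf_congr; apply: S0.
by apply: contraNneq x0 => Ux0; rewrite -(mulKmx uU x) Ux0 mulmx0.
Qed.

Definition schur (R : realType) (m : nat) (N : 'M[R]_(1 + m)) : 'M[R]_m :=
  drsubmx N - (N 0 0)^-1 *: (dlsubmx N *m (dlsubmx N)^T).

(** Completing the square in the first coordinate u of (u, y) turns u into
    u + t . y for this vector t. *)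
Definition schur_slope (R : realType) (m : nat) (N : 'M[R]_(1 + m)) : 'cV[R]_m :=
  (N 0 0)^-1 *: dlsubmx N.

Definition dotp (R : realType) (m : nat) (x y : 'cV[R]_m) : R := (x^T *m y) 0 0.

Lemma cV1E (R : nzRingType) (x : 'cV[R]_1) : x = (x 0 0)%:M.
Proof. by rewrite [LHS]mx11_scalar. Qed.

Lemma col_mx_decomp (R : nzRingType) (m : nat) (x : 'cV[R]_(1 + m)) :
  x = col_mx (x 0 0)%:M (dsubmx x).
Proof.
rewrite -[LHS]vsubmxK; congr (col_mx _ _); rewrite [LHS]cV1E; congr (_%:M).
by rewrite mxE; congr (x _ _); apply: val_inj.
Qed.

(** Completing the square, at the level of matrices: a rank one form plus a form
    in the remaining coordinates. *)
Lemma schur_block (R : realType) (m : nat) (N : 'M[R]_(1 + m)) :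
  N^T = N -> N 0 0 != 0 ->
  N = (row_mx 1%:M (schur_slope N)^T : 'M[R]_(1, 1 + m))^T *m
        (N 0 0 *: row_mx 1%:M (schur_slope N)^T) +
      block_mx 0 0 0 (schur N).
Proof.
move=> symN a0.
rewrite -[LHS]submxK -scalemxAr tr_row_mx mul_col_row scale_block_mx trmx1 trmxK.
rewrite !mul1mx !mulmx1 add_block_mx !addr0; congr (block_mx _ _ _ _).
- rewrite [LHS]cV1E scalemx1; congr (_%:M).
  by rewrite !mxE; congr (N _ _); apply: val_inj.
- rewrite /schur_slope [(_ *: _)^T]linearZ /= scalerA mulfV // scale1r.
  by rewrite trmx_dlsub symN.
- by rewrite /schur_slope scalerA mulfV // scale1r.
- rewrite /schur /schur_slope [(_ *: dlsubmx N)^T]linearZ /=.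
  rewrite -scalemxAl -scalemxAr !scalerA mulfV // mul1r addrC subrK //.
Qed.

Lemma qf_schur (R : realType) (m : nat) (N : 'M[R]_(1 + m)) u y :
  N^T = N -> N 0 0 != 0 ->
  qf N (col_mx u%:M y) =
    N 0 0 * (u + dotp (schur_slope N) y) ^+ 2 + qf (schur N) y.
Proof.
move=> symN a0; rewrite {1}(schur_block symN a0) /qf.
set v := row_mx _ _; set x := col_mx _ _.
have vx : v *m x = (u + dotp (schur_slope N) y)%:M.
  rewrite /v /x mul_row_col mul1mx raddfD /=; congr (_ + _).
  exact: mx11_scalar.
rewrite mulmxDr mulmxDl mxE; congr (_ + _).
  rewrite !mulmxA -scalemxAr -scalemxAl mxE; congr (_ * _).
  rewrite -trmx_mul vx -mulmxA vx tr_scalar_mx -scalar_mxM mxE eqxx mulr1n.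
  by rewrite expr2.
rewrite /x tr_col_mx mul_row_block mul_row_col !mulmx0 !add0r.
by rewrite mul0mx add0r.
Qed.

Lemma det_schur (R : realType) (m : nat) (N : 'M[R]_(1 + m)) :
  N^T = N -> N 0 0 != 0 -> \det N = N 0 0 * \det (schur N).
Proof.
move=> symN a0.
have E : N = block_mx 1%:M 0 (schur_slope N) 1%:M *m
              block_mx (N 0 0)%:M (N 0 0 *: (schur_slope N)^T) 0 (schur N).
  rewrite {1}(schur_block symN a0) mulmx_block !mul1mx !mul0mx !addr0.
  rewrite -scalemxAr tr_row_mx mul_col_row scale_block_mx trmx1 trmxK.
  rewrite !mul1mx !mulmx1 add_block_mx !addr0 scalemx1 -scalemxAr.
  by rewrite mul_mx_scalar.
by rewrite {1}E det_mulmx det_lblock det_ublock !det1 !mul1r det_scalar1.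
Qed.

Lemma posdef_diag (R : realType) (m : nat) (S : 'M[R]_m) i :
  posdef S -> 0 < S i i.
Proof.
move=> [_ S0]; have := S0 (delta_mx i 0).
rewrite /qf trmx_delta -rowE -colE mxE mxE; apply.
apply/eqP => /matrixP /(_ i 0); rewrite !mxE !eqxx => /eqP.
by rewrite oner_eq0.
Qed.

Lemma posdef_schur (R : realType) (m : nat) (N : 'M[R]_(1 + m)) :
  posdef N -> posdef (schur N).
Proof.
move=> pN; have a0 : N 0 0 != 0 by rewrite gt_eqF ?posdef_diag.
have [symN N0] := pN; split.
  rewrite /schur [LHS]linearB /= [(_ *: _)^T]linearZ /= trmx_mul trmxK.
  by rewrite trmx_drsub symN.
move=> y y0.
have := N0 (col_mx (- dotp (schur_slope N) y)%:M y).
rewrite qf_schur // addNr expr0n mulr0 add0r; apply.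
apply: contraNneq y0 => /(congr1 (@dsubmx _ _ _ _)).
by rewrite col_mxKd => ->; rewrite linear0.
Qed.

Lemma posdef_unit (R : realType) (m : nat) (N : 'M[R]_m) :
  posdef N -> 0 < \det N.
Proof.
elim: m N => [|m IH] N pN; first by rewrite det_mx00.
have a0 : 0 < (N : 'M[R]_(1 + m)) 0 0 by apply: posdef_diag.
rewrite (@det_schur _ m) ?gt_eqF //; last by case: pN.
by rewrite mulr_gt0 // IH //; apply: posdef_schur.
Qed.

(** * Separated families in the unit cube *)

Lemma col_mxB (R : realType) (m : nat) (u v : R) (x y : 'cV[R]_m) :
  ((col_mx u%:M x : 'cV[R]_m.+1) - (col_mx v%:M y : 'cV[R]_m.+1))%R =
  col_mx (u - v)%:M (x - y).
Proof.
transitivity (col_mx u%:M x - col_mx v%:M y : 'cV[R]_(1 + m)); first by [].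
by rewrite opp_col_mx add_col_mx -scalemx1 -[v%:M]scalemx1 -scalerBl scalemx1.
Qed.

(** A family of the size of the volume, as a product along the successive
    squares of the form: the next coordinate runs through multiples of
    [delta / Num.sqrt a], where [a] is the current leading coefficient, and the
    Schur complement separates the remaining coordinates. *)
Lemma posdef_separated (R : realType) (m : nat) (S : 'M[R]_m) (delta : R) :
  posdef S -> 0 < delta ->
  exists (I : finType) (w : I -> 'cV[R]_m),
    [/\ forall i k, 0 <= w i k 0 <= 1,
        forall i j, i != j -> delta ^+ 2 <= qf S (w i - w j) &
        \det S <= (delta ^+ 2) ^+ m * #|I|%:R ^+ 2].
Proof.
move=> + d0; elim: m S => [|m IH] S pS.
  exists unit, (fun=> 0); split=> [? []//|[] []//|].
  by rewrite det_mx00 expr0 card_unit expr1n mulr1.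
pose N : 'M[R]_(1 + m) := S; have pN : posdef N by [].
have [symN N0] := pN.
have a0 : 0 < N 0 0 by apply: posdef_diag.
have aN0 : N 0 0 != 0 by rewrite gt_eqF.
have [I [w [w01 wsep wcard]]] := IH _ (posdef_schur pN).
set a := N 0 0 in a0 aN0 *.
have s0 : 0 < Num.sqrt a by rewrite sqrtr_gt0.
pose e := delta / Num.sqrt a.
have e0 : 0 < e by rewrite divr_gt0.
have ae : a * e ^+ 2 = delta ^+ 2.
  by rewrite /e exprMn exprVn sqr_sqrtr ?ltW // mulrCA mulfV // mulr1.
pose K := Num.truncn e^-1.
have /andP[Ke eK] : K%:R <= e^-1 < K.+1%:R by apply: truncn_itv; rewrite invr_ge0 ltW.
exists (I * 'I_K.+1)%type.
exists (fun p : I * 'I_K.+1 => col_mx (p.2%:R * e)%:M (w p.1) : 'cV[R]_(1 + m)); split.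
- move=> [i k] j /=; rewrite mxE; case: splitP => j' _; last exact: w01.
  rewrite ord1 mxE eqxx mulr1n mulr_ge0 ?ler0n ?(ltW e0) //=.
  rewrite -ler_pdivlMr // div1r (le_trans _ Ke) // ler_nat -ltnS; exact: ltn_ord.
- move=> [i k] [j l] /= ijkl.
  rewrite col_mxB.
  rewrite (@qf_schur _ _ N) // -/a.
  have [ij|ij] := eqVneq i j; last first.
    apply: le_trans (wsep _ _ ij) _; rewrite lerDr.
    by rewrite mulr_ge0 ?sqr_ge0 // ltW.
  rewrite ij subrr /dotp mulmx0 mxE addr0 /qf mulmx0 mxE addr0.
  rewrite -mulrBl exprMn mulrCA ae ler_peMl ?sqr_ge0 //.
  have kl : k != l by apply: contra ijkl => /eqP ->; rewrite ij.
  rewrite -real_normK ?num_real // exprn_ege1 //.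
  wlog lk : k l {ijkl} kl / (l < k)%N.
    move=> H; case: (ltngtP l k) => [lk||/val_inj lk]; first exact: H.
      by move=> lk; rewrite distrC; apply: H => //; rewrite eq_sym.
    by rewrite lk eqxx in kl.
  rewrite -natrB; last exact: ltnW.
  by rewrite ger0_norm ?ler0n // ler1n subn_gt0.
- rewrite (@det_schur _ _ N) // card_prod card_ord natrM [_ ^+ m.+1]exprS -/a.
  apply: le_trans (_ : (delta ^+ 2 * K.+1%:R ^+ 2) *
     ((delta ^+ 2) ^+ m * #|I|%:R ^+ 2) <= _); last first.
    by rewrite le_eqVlt; apply/orP; left; apply/eqP; set u := _ ^+ m; ring.
  apply: ler_pM => //; [exact: ltW | exact/ltW/posdef_unit/posdef_schur |].
  rewrite -ae -mulrA ler_peMr ?(ltW a0) // -exprMn exprn_ege1 //.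
  by rewrite mulrC -ler_pdivrMr // div1r ltW.
Qed.

(** * Counting lattice points by the dual minimum *)

Lemma int_window (R : realType) (c h : R) : 0 <= h ->
  exists zs : seq int, (forall z : int, `|z%:~R + c| < h -> z \in zs) /\
    (size zs)%:R <= 2 * h + 1.
Proof.
move=> h0; set lo := Num.floor (- c - h) + 1.
exists [seq lo + k%:Z | k <- iota 0 (Num.truncn (2 * h)).+1]; split; last first.
  rewrite size_map size_iota -natr1 lerD2r.
  by have /andP[] : _ := truncn_itv (mulr_ge0 (ler0n R 2) h0).
move=> z; rewrite ltr_norml => /andP[z1 z2].
have [lo1 lo2] : (lo - 1)%:~R <= - c - h /\ - c - h < lo%:~R.
  by rewrite /lo addrK; have /andP[] := floor_itv (- c - h).
have zlo : 0 <= z - lo.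
  rewrite subr_ge0 -ltzD1 -(ltr_int R) intrD.
  by move: lo1; rewrite intrD rmorphN /= => lo1; lra.
apply/mapP; exists `|z - lo|%N; last by rewrite gez0_abs //; ring.
rewrite mem_iota /= add0n ltnS truncn_ge_nat ?mulr_ge0 //.
rewrite natr_absz ger0_norm // rmorphB /=; lra.
Qed.

(** The Smith form of a column is one multiple of the first basis vector. *)
Lemma int_col_completion (m : nat) (z : 'cV[int]_(1 + m)) :
  exists (U : 'M[int]_(1 + m)) (k : int),
    U \in unitmx /\ z = k *: (U *m delta_mx 0 0).
Proof.
have [L uL [V uV [d _ zE]]] := int_Smith_normal_form z.
exists L, (d`_0 * V 0 0); split => //; rewrite zE.
have -> : (\matrix_(i, j) (d`_i *+ (i == j :> nat)) : 'cV_(1 + m)) =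
          d`_0 *: delta_mx 0 0.
  apply/matrixP => i j; rewrite !mxE ord1 eqxx andbT.
  have [->|i0] := eqVneq i 0; first by rewrite eqxx mulr1n mulr1.
  by rewrite mulr0; move: i0; rewrite -val_eqE /= => /negPf ->.
rewrite [V in LHS]mx11_scalar mul_mx_scalar -scalemxAr scalerA.
by rewrite [d`_0 * _]mulrC.
Qed.

Lemma mul_schur (R : realType) (m : nat) (N : 'M[R]_(1 + m)) u y :
  N^T = N -> N 0 0 != 0 ->
  let s := N 0 0 * (u + dotp (schur_slope N) y) in
  N *m col_mx u%:M y = col_mx s%:M (s *: schur_slope N + schur N *m y).
Proof.
move=> symN a0 s; rewrite {1}(schur_block symN a0).
set v := row_mx _ _; set x := col_mx _ y.
have vx : v *m x = (u + dotp (schur_slope N) y)%:M.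
  rewrite /v /x mul_row_col mul1mx raddfD /=; congr (_ + _).
  exact: mx11_scalar.
rewrite mulmxDl -mulmxA -scalemxAl vx scale_scalar_mx -/s tr_row_mx trmx1 trmxK.
rewrite mul_col_mx mul1mx mul_mx_scalar /x mul_block_col !mul0mx !add0r.
by rewrite add_col_mx addr0.
Qed.

Lemma posdef_qf_ge0 (R : realType) (m : nat) (N : 'M[R]_m) y :
  posdef N -> 0 <= qf N y.
Proof.
move=> [_ N0]; have [->|/N0/ltW//] := eqVneq y 0.
by rewrite /qf mulmx0 mxE.
Qed.

(** The value of the inverse form of N at z + c is read off at the vector y that
    N sends to z + c, so that no inverse has to be carried through the
    induction. *)
Definition dual_count (R : realType) (m : nat) (r D : R) (N : 'M[R]_m) :=
  forall c : 'cV[R]_m, exists zs : seq 'cV[int]_m,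
    (forall z y, N *m y = map_mx intr z + c -> qf N y < r ^+ 2 -> z \in zs) /\
    (size zs)%:R <= D.

(** With a the leading coefficient and t the slope, the inverse form at x is
    x_0 ^ 2 / a plus the inverse of the Schur complement at x' - x_0 t. So the
    first coordinate runs through a window of half-width r sqrt a, and for each
    of its values the others are counted by the Schur complement with another
    translation. The bound on a from below absorbs the extra point of the
    window into the factor sqrt a. *)
Lemma dual_count_schur (R : realType) (m : nat) (mu r D : R)
    (N : 'M[R]_(1 + m)) :
  0 < mu -> 0 < r -> posdef N -> mu <= N 0 0 -> dual_count r D (schur N) ->
  dual_count r ((2 * r + (Num.sqrt mu)^-1) * Num.sqrt (N 0 0) * D) N.
Proof.
move=> mu0 r0 pN mua cN c; have [symN N0] := pN.
have a0 : 0 < N 0 0 by apply: posdef_diag.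
have aN0 : N 0 0 != 0 by rewrite gt_eqF.
set a := N 0 0 in mua a0 aN0 *; set t := schur_slope N.
have ra0 : 0 <= r * Num.sqrt a by rewrite mulr_ge0 ?sqrtr_ge0 ?ltW.
have [zs1 [zs1P zs1s]] := int_window (c 0 0) ra0.
have [f fP] := choice (fun z1 : int => cN (dsubmx c - (z1%:~R + c 0 0) *: t)).
exists [seq col_mx z1%:M z' | z1 <- zs1, z' <- f z1]; split; last first.
  have D0 : 0 <= D.
    by have [zs [_ /(le_trans _)]] := cN 0; apply; exact: ler0n.
  apply: le_trans (_ : (size zs1)%:R * D <= _).
    rewrite size_allpairs_dep.
    elim: zs1 {zs1P zs1s} => [|z1 s IH] /=; first by rewrite mul0r.
    by rewrite natrD -natr1 mulrDl mul1r addrC lerD //; case: (fP z1).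
  apply: ler_wpM2r => //; apply: le_trans zs1s _.
  rewrite [leRHS]mulrDl -[2 * r * _]mulrA lerD2l mulrC.
  by rewrite ler_pdivlMr ?sqrtr_gt0 // mul1r ler_wsqrtr.
move=> z y; rewrite [z]col_mx_decomp [y]col_mx_decomp.
set z1 := z 0 0; set z' := dsubmx z; set u := y 0 0; set y' := dsubmx y.
rewrite mul_schur // qf_schur // -/a -/t.
set s := u + dotp t y' => Ny qy.
have Ny1 : a * s = z1%:~R + c 0 0.
  move/matrixP: (Ny) => /(_ 0 0); rewrite !mxE.
  by case: splitP => // j _; rewrite !ord1 !mxE !eqxx !mulr1n.
have Ny2 : schur N *m y' = map_mx intr z' + (dsubmx c - (z1%:~R + c 0 0) *: t).
  move/(congr1 (@dsubmx _ _ _ _)): Ny; rewrite linearD /= col_mxKd -Ny1.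
  rewrite map_col_mx col_mxKd => Ny.
  by rewrite addrA -Ny addrAC subrr add0r.
have qN0 := posdef_qf_ge0 y' (posdef_schur pN).
have as0 : 0 <= a * s ^+ 2 by rewrite mulr_ge0 ?sqr_ge0 ?ltW.
apply/allpairsPdep; exists z1, z'; split => //.
  apply: zs1P; rewrite -Ny1 -(ltr_pXn2r (n := 2)) ?nnegrE //.
  rewrite real_normK ?num_real // exprMn exprMn sqr_sqrtr ?ltW //.
  by rewrite [a ^+ 2]expr2 -mulrA mulrC ltr_pM2r //; lra.
by have [fz _] := fP z1; apply: (fz _ y') => //; lra.
Qed.

Lemma dual_count_congr (R : realType) (m : nat) (r D : R) (N : 'M[R]_m)
    (V : 'M[int]_m) : V \in unitmx ->
  dual_count r D ((map_mx intr V)^T *m N *m map_mx intr V) -> dual_count r D N.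
Proof.
move=> uV cN c; set U : 'M[R]_m := map_mx intr V in cN *.
have uU : U \in unitmx by rewrite unitmxE det_map_mx rmorph_unit.
have [zs [zsP zss]] := cN (U^T *m c).
exists [seq invmx V^T *m z | z <- zs]; split; last by rewrite size_map.
move=> z y Ny qy; apply/mapP; exists (V^T *m z); last by rewrite mulKmx ?unitmx_tr.
apply: (zsP _ (invmx U *m y)); last by rewrite qf_congr mulKVmx.
by rewrite -[LHS]mulmxA mulKVmx // -mulmxA Ny mulmxDr map_mxM map_trmx.
Qed.

Lemma posdef_almost_min (R : realType) (m : nat) (mu : R) (N : 'M[R]_m.+1) :
  0 < mu ->
  (forall z : 'cV[int]_m.+1, z != 0 -> mu <= qf N (map_mx intr z)) ->
  exists2 z : 'cV[int]_m.+1, z != 0 & forall z' : 'cV[int]_m.+1, z' != 0 ->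
    qf N (map_mx intr z) <= 2 * qf N (map_mx intr z').
Proof.
move=> mu0 muN.
pose E := [set qf N (map_mx intr z) | z in [set z : 'cV[int]_m.+1 | z != 0]].
have e10 : (delta_mx 0 0 : 'cV[int]_m.+1) != 0.
  by apply/eqP => /matrixP/(_ 0 0)/eqP; rewrite !mxE.
have lbE : lbound E mu by move=> _ [z z0 <-]; exact: muN.
have infE : has_inf E by split; [exists (qf N (map_mx intr (delta_mx 0 0))); exists (delta_mx 0 0)|exists mu].
have muE : mu <= inf E by apply: lb_le_inf; [case: infE|].
have E0 : 0 < inf E by apply: lt_le_trans muE.
have [_ [z z0 <-] zE] := inf_adherent E0 infE.
exists z => // z' z'0.
have zz' : inf E <= qf N (map_mx intr z') by apply: inf_lbound; [case: infE|exists z'].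
lra.
Qed.

(** The first basis vector nearly minimizes the form. Rounding its coefficient to
    absolute value at most 1/2 lifts any vector of the Schur complement at the
    cost of a quarter of the leading coefficient, so the complement inherits a
    lower bound. *)
Lemma schur_min (R : realType) (m : nat) (mu : R) (N : 'M[R]_(1 + m)) :
  posdef N -> mu <= N 0 0 ->
  (forall z : 'cV[int]_(1 + m), z != 0 -> N 0 0 <= 2 * qf N (map_mx intr z)) ->
  forall z : 'cV[int]_m, z != 0 -> mu / 4 <= qf (schur N) (map_mx intr z).
Proof.
move=> pN mua minN z z0; have [symN N0] := pN.
have a0 : 0 < N 0 0 by apply: posdef_diag.
set x := dotp (schur_slope N) (map_mx intr z).
pose k : int := - Num.floor (x + 2^-1).
have kz0 : col_mx k%:M z != 0.
  by apply: contraNneq z0 => /(congr1 (@dsubmx _ _ _ _)); rewrite col_mxKd linear0 => ->.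
have := minN _ kz0; rewrite map_col_mx map_scalar_mx qf_schur ?gt_eqF // -/x.
have /andP[f1 f2] := floor_itv (x + 2^-1).
have : (k%:~R + x) ^+ 2 <= 4^-1.
  move: f1 f2; rewrite /k rmorphN /= intrD; set f := (Num.floor _)%:~R => f1 f2.
  have -> : (4^-1 : R) = (2^-1) ^+ 2 by field.
  rewrite -(real_normK (num_real _)) ler_pXn2r ?nnegrE ?invr_ge0 // ler_norml.
  by apply/andP; split; lra.
rewrite -(ler_pM2l a0); lra.
Qed.

(** This is the transference principle. In a basis whose first vector nearly
    minimizes the form, [schur_min] hands the hypothesis down to the Schur
    complement, and [dual_count_schur] multiplies the count by the square root of
    the leading coefficient, as the determinant requires. *)
Lemma posdef_dual_count (R : realType) (m : nat) (mu r : R) :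
  0 < mu -> 0 < r -> exists2 C, 0 <= C & forall N : 'M[R]_m, posdef N ->
    (forall z : 'cV[int]_m, z != 0 -> mu <= qf N (map_mx intr z)) ->
    dual_count r (C * Num.sqrt (\det N)) N.
Proof.
move=> + r0; elim: m mu => [|m IH] mu mu0.
  exists 1 => // N _ _ c; exists [:: 0]; split.
    by move=> z y _ _; rewrite flatmx0 inE.
  by rewrite det_mx00 sqrtr1 mulr1.
have mu40 : 0 < mu / 4 by rewrite divr_gt0.
have [C C0 CP] := IH _ mu40.
exists ((2 * r + (Num.sqrt mu)^-1) * C).
  by rewrite mulr_ge0 // addr_ge0 ?invr_ge0 ?sqrtr_ge0 // mulr_ge0 // ltW.
move=> N pN muN; have [z z0 zmin] := posdef_almost_min mu0 muN.
have [V [k [uV zE]]] := @int_col_completion m z.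
have k0 : k != 0 by apply: contraNneq z0 => k0; rewrite zE k0 scale0r.
apply: (dual_count_congr uV).
set U : 'M[R]_m.+1 := map_mx intr V.
have uU : U \in unitmx by rewrite unitmxE det_map_mx rmorph_unit.
set N1 : 'M[R]_(1 + m) := U^T *m N *m U.
have pN1 : posdef N1 := posdef_congr uU pN.
have a0 : 0 < N1 0 0 by apply: posdef_diag.
have N1z z' : qf N1 (map_mx intr z') = qf N (map_mx intr (V *m z')).
  by rewrite qf_congr map_mxM.
have Vz0 (z' : 'cV[int]_m.+1) : z' != 0 -> V *m z' != 0.
  by apply: contra_neq => Vz'; rewrite -(mulKmx uV z') Vz' mulmx0.
have N1a : N1 0 0 = qf N1 (map_mx intr (delta_mx 0 0)).
  by rewrite map_delta_mx /qf trmx_delta -rowE -colE [RHS]mxE [RHS]mxE.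
have e10 : (delta_mx 0 0 : 'cV[int]_m.+1) != 0.
  by apply/eqP => /matrixP/(_ 0 0)/eqP; rewrite !mxE.
have mua : mu <= N1 0 0 by rewrite N1a N1z; apply/muN/Vz0.
have amin z' : z' != 0 -> N1 0 0 <= 2 * qf N1 (map_mx intr z').
  move=> z'0; rewrite (N1z z'); apply: le_trans _ (zmin _ (Vz0 _ z'0)).
  rewrite zE map_mxZ qfZ -N1z -N1a ler_peMl ?(ltW a0) // -rmorphXn /= ler1z.
  by rewrite -gtz0_ge1 exprn_even_gt0.
have symN1 : N1^T = N1 by case: pN1.
have -> : \det N = N1 0 0 * \det (schur N1).
  rewrite -det_schur ?gt_eqF // /N1 !det_mulmx det_tr mulrAC -expr2 det_map_mx.
  rewrite -rmorphXn /= (_ : \det V ^+ 2 = 1) ?mul1r //.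
  have : \det V \is a GRing.unit by rewrite -unitmxE.
  by rewrite qualifE /= => /orP[]/eqP->.
rewrite sqrtrM ?(ltW a0) //.
rewrite mulrACA.
apply: (@dual_count_schur _ m) => //; apply: CP; first exact: posdef_schur.
exact: schur_min.
Qed.

(** * Counting lattice points in a ball *)

Definition nsq (R : realType) (m : nat) (x : 'cV[R]_m) : R :=
  \sum_i (x i 0) ^+ 2.

Lemma nsq_ge0 (R : realType) (m : nat) (x : 'cV[R]_m) : 0 <= nsq x.
Proof. by apply: sumr_ge0 => i _; exact: sqr_ge0. Qed.

Lemma enorm_lt (R : realType) (n : nat) (x : 'cV[R]_n.+1) r : 0 < r ->
  (enorm x < r) = (nsq x < r ^+ 2).
Proof.
move=> r0; rewrite /enorm -/(nsq x) -(ltr_pXn2r (n := 2)) ?nnegrE ?sqrtr_ge0 //.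
  by rewrite sqr_sqrtr ?nsq_ge0.
exact: ltW.
Qed.

Lemma int_box (m K : nat) : exists2 zs : seq 'cV[int]_m,
  (forall z : 'cV[int]_m, (forall i, `|z i 0| <= K%:Z) -> z \in zs) &
  size zs = ((2 * K).+1 ^ m)%N.
Proof.
exists [seq \col_i ((f i)%:Z - K%:Z) | f : {ffun 'I_m -> 'I_(2 * K).+1}].
  move=> z zK.
  have zK' i : (absz (z i 0 + K%:Z)%R < (2 * K).+1)%N by have := zK i; lia.
  apply/mapP; exists [ffun i => Ordinal (zK' i)]; rewrite ?mem_enum //.
  by apply/colP => i; rewrite !mxE ffunE /=; have := zK i; lia.
by rewrite size_map -cardE card_ffun !card_ord.
Qed.

(** A covering list yields both the finiteness and the cardinality that the
    counting estimate asks for. *)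
Definition counted (T : eqType) (S : set T) (N : nat) :=
  exists2 s : seq T, forall x, S x -> x \in s & (size s <= N)%N.

Lemma counted_fset_set (T : choiceType) (S : set T) (N : nat) :
  counted S N -> finite_set S /\ (#|` fset_set S| <= N)%N.
Proof.
move=> [s sP sN].
have SsubS : S `<=` [set` [fset x in s]%fset] by move=> x /sP xs /=; rewrite inE.
have finS : finite_set S by apply: sub_finite_set SsubS _; exact: finite_fset.
split=> //; apply: leq_trans sN; apply: leq_trans (size_undup s).
have -> : size (undup s) = #|` [fset x in s]%fset|.
  by rewrite card_fseq.
apply: fsubset_leq_card; apply/fsubsetP => x; rewrite in_fset_set // inE => xS.
by rewrite inE; apply: sP.
Qed.

Lemma sqr_le_nsq (R : realType) (m : nat) (x : 'cV[R]_m) i :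
  x i 0 ^+ 2 <= nsq x.
Proof.
by rewrite /nsq (bigD1 i) //= lerDl sumr_ge0 // => j _; exact: sqr_ge0.
Qed.

Lemma counted_ellipsoid (R : realType) (m : nat) (A : 'M[R]_m) r : 0 < r ->
  A \in unitmx -> exists N : nat,
  counted [set z : 'cV[int]_m | nsq (A *m map_mx intr z) < r ^+ 2] N.
Proof.
move=> r0 uA; pose c := \sum_i \sum_j `|invmx A i j| * r.
have [zs zsP _] := int_box m (Num.truncn c).+1.
exists (size zs); exists zs => // z /= zr; apply: zsP => i.
rewrite -(ler_int R); apply/ltW; apply: le_lt_trans (truncnS_gt c).
rewrite intr_norm (_ : (z i 0)%:~R = (invmx A *m (A *m map_mx intr z)) i 0).
  rewrite mxE (le_trans (ler_norm_sum _ _ _)) // /c [leRHS](bigD1 i) //=.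
  apply: le_trans (_ : \sum_j `|invmx A i j| * r <= _); last first.
    rewrite lerDl sumr_ge0 // => k _; rewrite sumr_ge0 // => j _.
    by rewrite mulr_ge0 ?(ltW r0).
  apply: ler_sum => k _; rewrite normrM ler_wpM2l //.
  rewrite -(ler_pXn2r (n := 2)) ?nnegrE ?(ltW r0) // real_normK ?num_real //.
  exact/ltW/(le_lt_trans (sqr_le_nsq _ _)).
by rewrite mulKmx // mxE.
Qed.

(** For N the Gram matrix of the inverse transpose of A, the inverse form of N is
    the squared norm of A z. *)
Lemma counted_dual (R : realType) (m : nat) (r : R) : 0 < r ->
  exists2 C, 0 <= C & forall A : 'M[R]_m, A \in unitmx ->
    (forall z : 'cV[int]_m, z != 0 -> 1 <= nsq ((invmx A)^T *m map_mx intr z)) ->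
    exists2 N : nat,
      counted [set z : 'cV[int]_m | nsq (A *m map_mx intr z) < r ^+ 2] N &
      N%:R <= C / `|\det A|.
Proof.
move=> r0; have [C C0 CP] := @posdef_dual_count R m 1 r ltr01 r0.
exists C => // A uA dualA.
have uiA : (invmx A)^T \in unitmx by rewrite unitmx_tr unitmx_inv.
have gramE : invmx A *m (invmx A)^T = (invmx A)^T^T *m (invmx A)^T.
  by rewrite trmxK.
have nsq_qf x : nsq ((invmx A)^T *m x) = qf (invmx A *m (invmx A)^T) x.
  by rewrite gramE qf_gram.
have [||zs [zsP zss]] := CP (invmx A *m (invmx A)^T) _ _ 0.
- by rewrite gramE; exact: posdef_gram.
- by move=> z /dualA; rewrite nsq_qf.
exists (size zs); last first.
  apply: le_trans zss _; rewrite det_mulmx det_tr -expr2 sqrtr_sqr.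
  by rewrite det_inv normfV.
exists zs => // z /= zr; apply: (zsP _ (A^T *m (A *m map_mx intr z))).
  by rewrite addr0 -mulmxA trmx_inv mulKmx ?unitmx_tr // mulKmx.
by rewrite -nsq_qf trmx_inv mulKmx ?unitmx_tr.
Qed.

(** * From escaping orbits to the counting estimate *)

Definition escapes (R : realType) (n : nat) (B : 'M[R]_n.+1)
    (G : set 'cV[R]_n.+1) :=
  forall r : R, 0 < r -> exists J : nat, forall j, (J <= j)%N ->
    forall v, G v -> v != 0 -> r ^+ 2 <= nsq (B ^+ j *m v).

Lemma unitmx_exp (R : realType) (n : nat) (B : 'M[R]_n.+1) (j : nat) :
  B \in unitmx -> B ^+ j \in unitmx.
Proof. by move=> uB; exact: (unitrX j (uB : B \is a GRing.unit)). Qed.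

Lemma unitmx_expz (R : realType) (n : nat) (B : 'M[R]_n.+1) (j : int) :
  B \in unitmx -> B ^ j \in unitmx.
Proof. by move=> uB; exact: (unitrXz j (uB : B \is a GRing.unit)). Qed.

Lemma det_expz (R : realType) (n : nat) (B : 'M[R]_n.+1) (j : int) :
  B \in unitmx -> \det (B ^ j) = \det B ^ j.
Proof.
move=> uB; have H (k : nat) : \det (B ^+ k) = \det B ^+ k.
  by elim: k => [|k IH]; rewrite ?det1 // !exprS det_mulmx IH.
case: j => k; first exact: H.
by rewrite !NegzE -!exprnN det_inv H.
Qed.

Lemma mul_exprzN (R : realType) (n : nat) (B : 'M[R]_n.+1) (j : int) :
  B \in unitmx -> B ^ (- j) *m B ^ j = 1%:M.
Proof.
move=> uB; rewrite [LHS](_ : _ = B ^ (- j) * B ^ j) //.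
by rewrite -(exprzDr (uB : B \is a GRing.unit)) addNr expr0z.
Qed.

Lemma trmx_exp (R : realType) (n : nat) (B : 'M[R]_n.+1) (j : nat) :
  (B ^+ j)^T = B^T ^+ j.
Proof.
by elim: j => [|j IH]; rewrite ?trmx1 // exprS exprSr trmx_mul IH.
Qed.

(** Points of the lattice in the image of the ball under [B ^+ j] are the
    integer vectors in an ellipsoid whose dual lattice is the image of the dual
    lattice under [B^T ^+ j]. That lattice has no short nonzero vector once j is
    large, so the volume bounds the count. For large negative j the lattice
    itself has left the ball except for 0. *)
Lemma counting_of_escapes (R : realType) (n : nat) (B P : 'M[R]_n.+1) :
  B \in unitmx -> P \in unitmx ->
  escapes B (lattice_of P) -> escapes B^T (lattice_of (invmx P)^T) ->
  lattice_counting_estimate B (lattice_of P).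
Proof.
move=> uB uP escB escBT r r0.
pose S j := lattice_of P `&` [set B ^ j *m x | x in eball r].
pose Q j c := exists2 N, counted (S j) N & N%:R <= c * Num.max 1 (`|\det B| ^ j).
have max1 (j : int) : 1 <= Num.max 1 (`|\det B| ^ j) by rewrite le_max lexx.
have Qmono j c c' : c <= c' -> Q j c -> Q j c'.
  move=> cc' [N cN Nc]; exists N => //; apply: le_trans Nc _.
  by rewrite ler_wpM2r // (le_trans ler01).
suff [C QC] : exists C, forall j, Q j C.
  exists C => j; have [N /counted_fset_set [fS SN] NC] := QC j.
  by split=> //; apply: le_trans NC; rewrite ler_nat.
pose A j := B ^ (- j) *m P.
have uA j : A j \in unitmx by rewrite unitmx_mul uP andbT unitmx_expz.
have SA j N : counted [set z : 'cV[int]_n.+1 | nsq (A j *m map_mx intr z) < r ^+ 2] N ->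
    counted (S j) N.
  move=> [zs zsP zsN]; exists [seq P *m map_mx intr z | z <- zs].
    move=> x [[z _ zx] [y yr yx]]; apply/mapP; exists z => //; apply: zsP => /=.
    rewrite -mulmxA zx -yx mulmxA mul_exprzN // mul1mx.
    by move: yr; rewrite /eball /= enorm_lt.
  by rewrite size_map.
have [J1 J1P] := escB r r0.
have [J2 J2P] := escBT 1 ltr01.
have [C C0 CP] := @counted_dual R n.+1 r r0.
pose J := maxn J1 J2.
have Qneg (j : nat) : (J <= j)%N -> Q (- j%:Z) 1.
  move=> Jj; exists 1%N; last by rewrite mul1r.
  exists [:: 0] => // x [[z _ zx] [y yr yx]]; rewrite inE.
  apply: contraTT yr => x0; rewrite /eball /= enorm_lt // -leNgt.
  have -> : y = B ^+ j *m x.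
    have := mul_exprzN (- j%:Z) uB; rewrite opprK => BB.
    by rewrite -yx mulmxA -[B ^+ j]/(B ^ j%:Z) BB mul1mx.
  apply: J1P => //; first exact: leq_trans (leq_maxl _ _) Jj.
  by exists z.
have Qpos (j : nat) : (J <= j)%N -> Q j%:Z (C / `|\det P|).
  move=> Jj; have [||N cN NC] := CP (A j%:Z).
  - exact: uA.
  - move=> z z0.
    have -> : (invmx (A j%:Z))^T = B^T ^+ j *m (invmx P)^T.
      rewrite -trmx_exp -trmx_mul; congr (_^T).
      apply: (can_inj (mulKmx (uA j%:Z))); rewrite mulmxV //.
      by rewrite /A mulmxA -[_ *m P *m _]mulmxA mulmxV // mulmx1 mul_exprzN.
    rewrite -mulmxA -[leLHS](expr1n _ 2); apply: J2P.
    + exact: leq_trans (leq_maxr _ _) Jj.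
    + by exists z.
    + have uPT : (invmx P)^T \in unitmx by rewrite unitmx_tr unitmx_inv.
      apply: contra_neq z0 => Pz0.
      have := mulKmx uPT (map_mx intr z : 'cV[R]_n.+1).
      rewrite Pz0 mulmx0 => /esym/matrixP z0; apply/matrixP => k l.
      by have := z0 k l; rewrite !mxE => /eqP; rewrite intr_eq0 => /eqP.
  exists N; first exact: SA.
  apply: le_trans NC _; rewrite /A det_mulmx det_expz // normrM invfM mulrA.
  rewrite -invr_expz normfV invrK -exprnP normrX mulrAC ler_wpM2l ?divr_ge0 //.
  by rewrite le_max lexx orbT.
have Qmid (j : int) : exists2 c, 0 <= c & Q j c.
  have [N cN] := counted_ellipsoid r0 (uA j); exists N%:R => //.
  by exists N; [exact: SA|rewrite ler_peMr].
have [C' C'0 QC'] : exists2 C', 0 <= C' &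
    forall j : nat, (j < J)%N -> Q j%:Z C' /\ Q (- j%:Z) C'.
  elim: (J) => [|k [c c0 ck]]; first by exists 0.
  have [c1 c10 Qc1] := Qmid k%:Z; have [c2 c20 Qc2] := Qmid (- k%:Z).
  exists (c + c1 + c2) => [|j]; first by rewrite !addr_ge0.
  rewrite ltnS leq_eqVlt => /predU1P[->|jk].
    by split; [apply: Qmono Qc1|apply: Qmono Qc2]; lra.
  by have [cp cn] := ck _ jk; split; [apply: Qmono cp|apply: Qmono cn]; lra.
have CP0 : 0 <= C / `|\det P| by rewrite divr_ge0.
exists (1 + C / `|\det P| + C') => j.
have [[k ->]|[k ->]] : (exists k : nat, j = k%:Z) \/ (exists k : nat, j = - k%:Z).
- by case: j => k; [left; exists k|right; exists k.+1; rewrite NegzE].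
- have [kJ|Jk] := ltnP k J.
    by have [Qk _] := QC' _ kJ; apply: Qmono Qk; lra.
  by apply: Qmono (Qpos _ Jk); lra.
- have [kJ|Jk] := ltnP k J.
    by have [_ Qk] := QC' _ kJ; apply: Qmono Qk; lra.
  by apply: Qmono (Qneg _ Jk); lra.
Qed.

(** * Shears with disjoint preimages of a thin set *)

Definition shear (R : realType) (n : nat) (i : 'I_n.+1) (w : 'cV[R]_n.+1) :
    'M[R]_n.+1 :=
  1%:M + w *m delta_mx 0 i.

Lemma shearE (R : realType) (n : nat) (i : 'I_n.+1) (w v : 'cV[R]_n.+1) :
  shear i w *m v = v + v i 0 *: w.
Proof.
rewrite mulmxDl mul1mx -mulmxA -rowE; congr (_ + _).
by rewrite [row i v]mx11_scalar mul_mx_scalar mxE.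
Qed.

Lemma Cauchy_Schwarz_nsq (R : realType) (m : nat) (a b : 'cV[R]_m) :
  dotp a b ^+ 2 <= nsq a * nsq b.
Proof.
have [a0|a0] := eqVneq (nsq a) 0.
  by rewrite (sum_sqr_eq0 a0) /dotp trmx0 mul0mx mxE expr0n /= mulr_ge0 ?nsq_ge0.
have ap : 0 < nsq a by rewrite lt_neqAle eq_sym a0 nsq_ge0.
have dotE : dotp a b = \sum_i a i 0 * b i 0.
  by rewrite /dotp mxE; apply: eq_bigr => i _; rewrite mxE.
have nsqE (k l : R) : nsq (k *: b - l *: a) =
    k ^+ 2 * nsq b - 2 * k * l * dotp a b + l ^+ 2 * nsq a.
  rewrite dotE /nsq !mulr_sumr -sumrB -big_split /=; apply: eq_bigr => i _.
  by rewrite !mxE; ring.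
have : 0 <= nsq a * (nsq a * nsq b - dotp a b ^+ 2).
  apply: le_trans (nsq_ge0 (nsq a *: b - dotp a b *: a)) _.
  by rewrite nsqE le_eqVlt; apply/orP; left; apply/eqP; ring.
by rewrite pmulr_rge0 // subr_ge0.
Qed.

Lemma nsqB_lt (R : realType) (m : nat) (x y : 'cV[R]_m) s :
  nsq x < s -> nsq y < s -> nsq (x - y) < 4 * s.
Proof.
move=> xs ys; apply: le_lt_trans (_ : 2 * nsq x + 2 * nsq y < _); last lra.
rewrite /nsq !mulr_sumr -big_split /=; apply: ler_sum => i _; rewrite !mxE.
by rewrite -subr_ge0; have := sqr_ge0 (x i 0 + y i 0); lra.
Qed.

Lemma nsqZ (R : realType) (m : nat) k (x : 'cV[R]_m) :
  nsq (k *: x) = k ^+ 2 * nsq x.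
Proof.
by rewrite /nsq mulr_sumr; apply: eq_bigr => i _; rewrite mxE exprMn.
Qed.

Definition insert0 (R : realType) (n : nat) (i : 'I_n.+1) (w : 'cV[R]_n) :
    'cV[R]_n.+1 :=
  \col_k oapp (fun l => w l 0) 0 (unlift i k).

Lemma insert0_id (R : realType) (n : nat) (i : 'I_n.+1) (w : 'cV[R]_n) :
  insert0 i w i 0 = 0.
Proof. by rewrite mxE unlift_none. Qed.

Lemma insert0_lift (R : realType) (n : nat) (i : 'I_n.+1) (w : 'cV[R]_n) k :
  insert0 i w (lift i k) 0 = w k 0.
Proof. by rewrite mxE liftK. Qed.

Lemma insert0B (R : realType) (n : nat) (i : 'I_n.+1) (w w' : 'cV[R]_n) :
  insert0 i w - insert0 i w' = insert0 i (w - w').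
Proof.
by apply/colP => k; rewrite !mxE; case: unliftP => [l|] _ /=; rewrite ?mxE ?subr0.
Qed.

Lemma qf_insert0 (R : realType) (n : nat) (i : 'I_n.+1) (S : 'M[R]_n.+1) w :
  qf S (insert0 i w) = qf (row' i (col' i S)) w.
Proof.
rewrite /qf !mxE (bigD1_ord i) //= insert0_id mulr0 add0r.
apply: eq_bigr => k _; rewrite insert0_lift; congr (_ * _).
rewrite !mxE (bigD1_ord i) //= mxE insert0_id mul0r add0r.
by apply: eq_bigr => l _; rewrite [in LHS]mxE insert0_lift !mxE.
Qed.

Lemma posdef_minor (R : realType) (n : nat) (i : 'I_n.+1) (S : 'M[R]_n.+1) :
  posdef S -> posdef (row' i (col' i S)).
Proof.
move=> [symS S0]; split.
  by apply/matrixP => k l; rewrite !mxE -{1}symS mxE.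
move=> w w0; rewrite -qf_insert0; apply: S0.
apply: contra_neq w0 => /colP w0; apply/colP => k.
by rewrite -(insert0_lift i) w0 !mxE.
Qed.

(** The minor of a Gram matrix is its determinant times the squared norm of a
    row of the inverse. A point of the thin set with large i-th coordinate forces
    that row to be long, so the hyperplane section of the parallelepiped is
    large and contains many separated shear vectors. Two shears that bring the
    same v into the thin set would displace it by less than the separation. *)
Lemma shear_packing (R : realType) (n : nat) (A : 'M[R]_n.+1) (i : 'I_n.+1)
    (r X : R) (y : 'cV[R]_n.+1) :
  A \in unitmx -> 0 < r -> 0 < X -> nsq (A *m y) < r ^+ 2 -> X < `|y i 0| ->
  exists (I : finType) (w : I -> 'cV[R]_n.+1),
    [/\ forall a, w a i 0 = 0, forall a k, 0 <= w a k 0 <= 1,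
        forall a b (v : 'cV[R]_n.+1), X < `|v i 0| ->
          nsq (A *m (shear i (w a) *m v)) < r ^+ 2 ->
          nsq (A *m (shear i (w b) *m v)) < r ^+ 2 -> a = b &
        `|\det A| * X ^+ n.+1 <= (2 * r) ^+ n.+1 * #|I|%:R].
Proof.
move=> uA r0 X0 yr yX; pose S := A^T *m A.
have pS : posdef S by exact: posdef_gram.
have d0 : 0 < 2 * r / X by rewrite divr_gt0 // mulr_gt0.
have [I [w [w01 wsep wcard]]] := posdef_separated (posdef_minor i pS) d0.
exists I, (fun a => insert0 i (w a)); split.
- by move=> a; exact: insert0_id.
- by move=> a k; rewrite mxE; case: unliftP => [l|] _ /=; rewrite ?lexx ?ler01.
- move=> a b v vX va vb; apply/eqP; apply: contraT => /wsep.
  rewrite -qf_insert0 -insert0B qf_gram -/(nsq _) => ab.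
  have := nsqB_lt va vb; rewrite -mulmxBr !shearE opprD addrACA subrr add0r.
  rewrite -scalerBr -scalemxAr nsqZ => H; exfalso.
  have : X ^+ 2 * (2 * r / X) ^+ 2 <= v i 0 ^+ 2 * nsq (A *m (insert0 i (w a) - insert0 i (w b))).
    rewrite ler_pM ?sqr_ge0 // -[leRHS]real_normK ?num_real //.
    by rewrite ler_pXn2r ?nnegrE ?(ltW X0) ?(ltW vX).
  rewrite -exprMn mulrCA mulfV ?gt_eqF // mulr1 => /le_lt_trans/(_ H).
  by rewrite exprMn -natrX ltxx.
- set rho := nsq ((row i (invmx A))^T).
  have minorE : \det (row' i (col' i S)) = \det A ^+ 2 * rho.
    have -> : \det (row' i (col' i S)) = (\adj S) i i.
      by rewrite mxE /cofactor -signr_odd oddD addbb mul1r.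
    have uS : S \in unitmx by rewrite unitmx_mul unitmx_tr uA.
    have -> : \adj S = \det S *: invmx S.
      by rewrite /invmx uS scalerA mulfV ?scale1r // -unitfE -unitmxE.
    rewrite /S det_mulmx det_tr -expr2 mxE; congr (_ * _).
    rewrite (_ : invmx _ = invmx A *m (invmx A)^T).
      by rewrite mxE; apply: eq_bigr => k _; rewrite !mxE expr2.
    apply: (can_inj (mulKmx uS)); rewrite mulmxV //.
    by rewrite -mulmxA mulKVmx // trmx_inv mulmxV // unitmx_tr.
  have Xrho : X ^+ 2 <= rho * r ^+ 2.
    have yE : y i 0 = dotp ((row i (invmx A))^T) (A *m y).
      by rewrite /dotp trmxK -row_mul mulKmx // mxE.
    apply: le_trans (_ : `|y i 0| ^+ 2 <= _).
      by rewrite ler_pXn2r ?nnegrE ?(ltW X0) ?(ltW yX).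
    rewrite real_normK ?num_real // yE; apply: le_trans (Cauchy_Schwarz_nsq _ _) _.
    by rewrite ler_wpM2l ?nsq_ge0 // ltW.
  rewrite -(ler_pXn2r (n := 2)) ?nnegrE ?mulr_ge0 ?exprn_ge0 ?mulr_ge0 ?(ltW X0) ?(ltW r0) //.
  rewrite minorE in wcard.
  have XX : (2 * r / X) ^+ 2 * X ^+ 2 = 2 ^+ 2 * r ^+ 2.
    by rewrite -exprMn mulfVK ?gt_eqF // exprMn.
  rewrite !exprMn real_normK ?num_real // -!exprM ![(n.+1 * 2)%N]mulnC !exprM.
  rewrite ![(_ ^+ 2) ^+ n.+1]exprS.
  set u := (X ^+ 2) ^+ n.
  have u0 : 0 <= u by rewrite exprn_ge0 ?sqr_ge0.
  apply: le_trans (_ : \det A ^+ 2 * rho * (r ^+ 2 * u) <= _).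
    rewrite -subr_ge0 (_ : _ - _ = (\det A ^+ 2 * u) * (rho * r ^+ 2 - X ^+ 2)).
      apply: mulr_ge0; first exact: mulr_ge0 (sqr_ge0 _) u0.
      by rewrite subr_ge0.
    by ring.
  have ru0 : 0 <= r ^+ 2 * u by rewrite mulr_ge0 ?sqr_ge0.
  apply: le_trans (ler_wpM2r ru0 wcard) _.
  set v := ((2 * r / X) ^+ 2) ^+ n.
  have vu : v * u = (2 ^+ 2) ^+ n * (r ^+ 2) ^+ n by rewrite -[LHS]exprMn XX exprMn.
  rewrite [leLHS](_ : _ = (v * u) * (r ^+ 2 * #|I|%:R ^+ 2)); last by ring.
  rewrite vu; set p := (2 ^+ 2) ^+ n; set q := (r ^+ 2) ^+ n.
  have T0 : 0 <= p * q * (r ^+ 2 * #|I|%:R ^+ 2).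
    apply: mulr_ge0; last by apply: mulr_ge0; exact: sqr_ge0.
    by apply: mulr_ge0; apply: exprn_ge0; exact: sqr_ge0.
  rewrite -subr_ge0 (_ : _ - _ = 3 * (p * q * (r ^+ 2 * #|I|%:R ^+ 2))).
    by rewrite mulr_ge0.
  by ring.
Qed.

(** * Continuity of matrix operations *)

(** Neighbourhoods of a matrix are generated by entrywise conditions. *)
Lemma continuous_mx (R : realType) (T : topologicalType) (p q : nat)
    (f : T -> 'M[R]_(p, q)) :
  (forall i j, continuous (fun x => f x i j)) -> continuous f.
Proof.
move=> cf x A [P xP PA].
apply: (@filterS _ (nbhs x) _ [set y | forall i j, P i j (f y i j)]).
  by move=> y /PA.
apply: filter_forall => i; apply: filter_forall => j.
exact: (cf i j x _ (xP i j)).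
Qed.

Lemma continuous_coord (R : realType) (T : topologicalType) (p q : nat)
    (f : T -> 'M[R]_(p, q)) i j :
  continuous f -> continuous (fun x => f x i j).
Proof.
move=> cf x; apply: (@continuous_comp _ _ _ f (fun M : 'M[R]_(p, q) => M i j)).
  exact: cf.
exact: coord_continuous.
Qed.

Lemma continuous_sumr (R : realType) (T : topologicalType) (I : Type) (s : seq I)
    (f : I -> T -> R) : (forall i, continuous (f i)) ->
  continuous (fun x => \sum_(i <- s) f i x).
Proof.
by move=> cf; apply: continuous_big => [|i _]; [exact: add_continuous|exact: cf].
Qed.

Lemma continuous_prodr (R : realType) (T : topologicalType) (I : Type)
    (s : seq I) (f : I -> T -> R) : (forall i, continuous (f i)) ->
  continuous (fun x => \prod_(i <- s) f i x).
Proof.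
by move=> cf; apply: continuous_big => [|i _]; [exact: mul_continuous|exact: cf].
Qed.

Lemma continuous_mulr (R : realType) (T : topologicalType) (f g : T -> R) :
  continuous f -> continuous g -> continuous (fun x => f x * g x).
Proof. by move=> cf cg x; apply: continuousM; [exact: cf|exact: cg]. Qed.

Lemma continuous_normr (R : realType) (T : topologicalType) (f : T -> R) :
  continuous f -> continuous (fun x => `|f x|).
Proof.
move=> cf x; apply: (@continuous_comp _ _ _ f (fun y : R => `|y|)).
  exact: cf.
exact: norm_continuous.
Qed.

Lemma continuous_mulmx (R : realType) (T : topologicalType) (p q s : nat)
    (f : T -> 'M[R]_(p, q)) (g : T -> 'M[R]_(q, s)) :
  continuous f -> continuous g -> continuous (fun x => f x *m g x).
Proof.
move=> cf cg; apply: continuous_mx => i j.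
under eq_fun do rewrite mxE.
apply: continuous_sumr => k; apply: continuous_mulr; exact: continuous_coord.
Qed.

Lemma continuous_det (R : realType) (T : topologicalType) (p : nat)
    (f : T -> 'M[R]_p) : continuous f -> continuous (fun x => \det (f x)).
Proof.
move=> cf; apply: continuous_sumr => s; apply: continuous_mulr.
  by move=> x; exact: cst_continuous.
by apply: continuous_prodr => i; exact: continuous_coord.
Qed.

Lemma continuous_adj (R : realType) (T : topologicalType) (p : nat)
    (f : T -> 'M[R]_p) : continuous f -> continuous (fun x => \adj (f x)).
Proof.
move=> cf; apply: continuous_mx => i j.
under eq_fun do rewrite mxE.
apply: continuous_mulr; first by move=> x; exact: cst_continuous.
apply: continuous_det; apply: continuous_mx => k l.
under eq_fun do rewrite !mxE.
exact: continuous_coord.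
Qed.

Lemma continuous_trmx (R : realType) (T : topologicalType) (p q : nat)
    (f : T -> 'M[R]_(p, q)) : continuous f -> continuous (fun x => (f x)^T).
Proof.
move=> cf; apply: continuous_mx => i j.
under eq_fun do rewrite mxE.
exact: continuous_coord.
Qed.

Lemma continuous_invmx (R : realType) (T : topologicalType) (p : nat)
    (f : T -> 'M[R]_p) : continuous f -> (forall x, f x \in unitmx) ->
  continuous (fun x => invmx (f x)).
Proof.
move=> cf uf; apply: continuous_mx => i j.
rewrite (_ : (fun x => _) = fun x => (\det (f x))^-1 * (\adj (f x)) i j).
  apply: continuous_mulr; last by apply: continuous_coord; exact: continuous_adj.
  move=> x; apply: (@continuousV _ _ (fun y => \det (f y)) x).
    by rewrite -unitfE -unitmxE.
  exact: continuous_det.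
by apply/funext => x; rewrite /invmx uf mxE.
Qed.

Lemma open_lt_cont (R : realType) (T : topologicalType) (f g : T -> R) :
  continuous f -> continuous g -> open [set x | f x < g x].
Proof.
move=> cf cg.
have -> : [set x | f x < g x] = (fun x => g x - f x) @^-1` [set y | 0 < y].
  by apply/seteqP; split=> x /=; rewrite subr_gt0.
apply: open_comp; last exact: open_gt.
by move=> x _; apply: continuousB; [exact: cg|exact: cf].
Qed.

Lemma open_forall (T : topologicalType) (I : finType) (U : I -> set T) :
  (forall i, open (U i)) -> open [set x | forall i, U i x].
Proof.
move=> oU; rewrite openE => x Ux; apply: filter_forall => i.
exact: (open_nbhs_nbhs (conj (oU i) (Ux i))).
Qed.


(** * The measure of the lattices with a vector in a thin shell *)

(** What the measure estimates use of the space of lattices and of the linear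
    group alike. The map f lifts the shear to T; the factor n.+2 is the growth of
    the entries of a basis and of its inverse under a shear. *)
Record lattice_flow (R : realType) (n : nat) d (T : measurableType d)
    (mu : {measure set T -> \bar R}) (Lam : T -> set 'cV[R]_n.+1)
    (K : nat -> set T) : Prop := LatticeFlow {
  flow_measurable : forall M, measurable (K M);
  flow_finite : forall M, (mu (K M) < +oo)%E;
  flow_cover : forall x, exists M, K M x;
  flow_basis : forall M x, K M x -> exists P : 'M[R]_n.+1,
    [/\ P \in unitmx, Lam x = lattice_of P &
        forall k l, `|P k l| <= M%:R /\ `|invmx P k l| <= M%:R];
  flow_hits : forall U : set 'cV[R]_n.+1, open U ->
    measurable [set x | Lam x `&` U !=set0];
  flow_shear : forall i (w : 'cV[R]_n.+1), w i 0 = 0 ->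
    (forall k, 0 <= w k 0 <= 1) -> exists f : T -> T,
    [/\ forall A, measurable A -> measurable (f @^-1` A),
        forall A, measurable A -> mu (f @^-1` A) = mu A,
        forall x, Lam (f x) = [set shear i w *m v | v in Lam x] &
        forall M x, K M (f x) -> K (n.+2 * M)%N x] }.

(** Integrate the number of sets F a that contain a given point. *)
Lemma sum_measure_le (R : realType) d (T : measurableType d)
    (mu : {measure set T -> \bar R}) (I : finType) (F : I -> set T)
    (K : set T) (N : nat) :
  (forall a, measurable (F a)) -> measurable K -> (forall a, F a `<=` K) ->
  (forall x, (#|[pred a | x \in F a]| <= N)%N) ->
  (\sum_(a : I) mu (F a) <= N%:R%:E * mu K)%E.
Proof.
move=> mF mK FK FN.
have -> : (\sum_(a : I) mu (F a) = \int[mu]_x \sum_(a : I) (\1_(F a) x)%:E)%E.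
  rewrite ge0_integral_sum //.
  - by apply: eq_bigr => a _; rewrite integral_indic // setIT.
  - by move=> a; exact/measurable_EFinP/measurable_indic.
have -> : (N%:R%:E * mu K = \int[mu]_x (N%:R%:E * (\1_K x)%:E))%E.
  rewrite ge0_integralZl //.
    by rewrite integral_indic // setIT.
  exact/measurable_EFinP/measurable_indic.
apply: ge0_le_integral => //.
- by move=> x _; apply: sume_ge0 => a _; rewrite lee_fin.
- by apply: emeasurable_sum => a; exact/measurable_EFinP/measurable_indic.
- by apply: measurable_funeM; exact/measurable_EFinP/measurable_indic.
move=> x _; rewrite -EFinM sumEFin lee_fin [\1_K x]indicE.
rewrite [leLHS](_ : _ = #|[pred a | x \in F a]|%:R); last first.
  rewrite -sum1_card natr_sum [RHS]big_mkcond /=; apply: eq_bigr => a _.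
  by rewrite indicE unfold_in /=; case: (x \in F a).
have [xK|xK] := boolP (x \in K); first by rewrite mulr1 ler_nat.
rewrite mulr0 eq_card0 // => a; rewrite !inE /=.
by apply: contraNF xK => /set_mem/FK/mem_set.
Qed.

Definition thin_shell (R : realType) (n : nat) (A : 'M[R]_n.+1) (i : 'I_n.+1)
    (r X : R) : set 'cV[R]_n.+1 :=
  [set y | [/\ nsq (A *m y) < r ^+ 2, X < `|y i 0| & forall k, `|y k 0| < 4 * X]].

Lemma open_thin_shell (R : realType) (n : nat) (A : 'M[R]_n.+1) i r X :
  open (thin_shell A i r X).
Proof.
have cE k : continuous (fun v : 'cV[R]_n.+1 => `|v k 0|).
  by apply: continuous_normr; exact: coord_continuous.
have cst (c : R) : continuous (fun _ : 'cV[R]_n.+1 => c).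
  by move=> v; exact: cst_continuous.
have -> : thin_shell A i r X =
    [set v | nsq (A *m v) < r ^+ 2] `&` [set v | X < `|v i 0|] `&`
    [set v | forall k, `|v k 0| < 4 * X].
  by apply/seteqP; split=> v; [move=> [? ? ?]|move=> [[? ?] ?]].
apply: openI; first apply: openI.
- apply: open_lt_cont => //; apply: continuous_sumr => k.
  have cAv : continuous (fun v : 'cV[R]_n.+1 => A *m v).
    by apply: continuous_mulmx => v; [exact: cst_continuous|exact].
  by apply: continuous_mulr; apply: continuous_coord.
- exact: open_lt_cont.
- by apply: open_forall => k; exact: open_lt_cont.
Qed.

Lemma entry_le (R : realType) (n : nat) (Q : 'M[R]_n.+1) (v : 'cV[R]_n.+1)
    (M s : R) k : 0 <= s ->
  (forall k l, `|Q k l| <= M) -> (forall l, `|v l 0| <= s) ->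
  `|(Q *m v) k 0| <= n.+1%:R * (M * s).
Proof.
move=> s0 QM vs; rewrite mxE; apply: le_trans (ler_norm_sum _ _ _) _.
apply: le_trans (_ : \sum_(l < n.+1) M * s <= _); last first.
  by rewrite sumr_const card_ord mulr_natl.
apply: ler_sum => l _; rewrite normrM; apply: ler_pM => //; exact: normr_ge0.
Qed.

(** The preimages under the shears of the event that the lattice meets the thin
    shell have the same measure and lie in a fixed set of finite measure. A
    point belongs to few of them: distinct shears use distinct lattice vectors
    with entries at most 8 X, and there are at most a constant times X ^+ n.+1
    such vectors. *)
Lemma thin_shell_measure (R : realType) (n : nat) d (T : measurableType d)
    (mu : {measure set T -> \bar R}) (Lam : T -> set 'cV[R]_n.+1)
    (K : nat -> set T) (M : nat) (r X0 : R) :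
  lattice_flow mu Lam K -> 0 < r -> 0 < X0 -> exists2 C : R, 0 <= C &
  forall (A : 'M[R]_n.+1) i X, A \in unitmx -> X0 <= X ->
    (mu (K M `&` [set x | Lam x `&` thin_shell A i r X !=set0])
       <= (C / `|\det A|)%:E)%E.
Proof.
move=> fl r0 X00; set M' := (n.+2 * M)%N; set d' := n.+1%:R : R.
have [mK finK _ basisK hitsT shearT] := fl.
pose b : R := d' * (M'%:R * 8).
have b0 : 0 <= b by rewrite !mulr_ge0.
pose D := (2 * b + X0^-1) ^+ n.+1.
have D0 : 0 <= D by rewrite exprn_ge0 // addr_ge0 ?mulr_ge0 // invr_ge0 ltW.
pose m := fine (mu (K M')).
have m0 : 0 <= m by rewrite fine_ge0.
have mE : mu (K M') = m%:E by rewrite fineK // ge0_fin_numE.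
exists (D * m * (2 * r) ^+ n.+1).
  by rewrite !mulr_ge0 // exprn_ge0 // mulr_ge0 // ltW.
move=> A i X uA X0X; set S := thin_shell A i r X.
have Xp : 0 < X by apply: lt_le_trans X0X.
set E := K M `&` _.
have mE' : measurable E by apply: measurableI => //; exact/hitsT/open_thin_shell.
have [E0|] := pselect (E = set0).
  rewrite E0 measure0 lee_fin !mulr_ge0 ?invr_ge0 // exprn_ge0 // mulr_ge0 //.
  exact: ltW.
move/eqP/set0P => [x0 [_ [y [_ [yr yX _]]]]].
have [I [w [w0 w01 winj wcard]]] := shear_packing uA r0 Xp yr yX.
have [f fP] := choice (fun a => shearT i (w a) (w0 a) (w01 a)).
pose F a := f a @^-1` E.
have mF a : measurable (F a) by have [mf _ _ _] := fP a; exact: mf.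
have muF a : mu (F a) = mu E by have [_ pf _ _] := fP a; exact: pf.
have FK a : F a `<=` K M'.
  by have [_ _ _ Kf] := fP a; move=> x [/Kf].
(* Lattice vectors with entries at most 8 X have coordinates at most b X in the
   bounded basis; N counts the integer vectors in that box. *)
pose N := ((2 * (Num.truncn (b * X))).+1 ^ n.+1)%N.
have ND : N%:R <= D * X ^+ n.+1.
  rewrite /N natrX /D -exprMn lerXn2r ?nnegrE //.
    by rewrite mulr_ge0 ?(ltW Xp) // addr_ge0 ?mulr_ge0 // invr_ge0 ltW.
  have bX0 : 0 <= b * X by rewrite mulr_ge0 // ltW.
  have /andP[tr _] := truncn_itv bX0.
  rewrite -[(_ * _).+1%:R]natr1 natrM [leRHS]mulrDl -[2 * b * X]mulrA lerD //; first by rewrite ler_wpM2l.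
  by rewrite ler_pdivlMl // mulr1.
have FN x : (#|[pred a | x \in F a]| <= N)%N.
  have [Kx|nKx] := pselect (K M' x); last first.
    rewrite eq_card0 // => a; rewrite !inE /=.
    by apply/negbTE/negP => /set_mem/FK.
  have [P [uP LP Pb]] := basisK _ _ Kx.
  have [zs zsP zss] := int_box n.+1 (Num.truncn (b * X)).
  have /choice [z zP] : forall a, exists z : 'cV[int]_n.+1, x \in F a ->
      z \in zs /\ S (shear i (w a) *m (P *m map_mx intr z)).
    move=> a; have [xF|] := boolP (x \in F a); last by exists 0.
    have [_ [u [+ Su]]] : E (f a x) by exact: set_mem xF.
    have [_ _ Lf _] := fP a; rewrite Lf LP => -[_ [z _ <-] zu].
    exists z => _; rewrite zu; split => //; apply: zsP => k.
    have [_ _ u4X] := Su; move: zu; rewrite shearE.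
    set v := P *m _ => zu.
    have vi : `|v i 0| < 4 * X.
      by have := u4X i; rewrite -zu !mxE w0 mulr0 addr0.
    have v8 l : `|v l 0| <= 8 * X.
      have -> : v l 0 = u l 0 - v i 0 * w a l 0 by rewrite -zu !mxE addrK.
      have /andP[wl0 wl1] := w01 a l.
      apply: le_trans (ler_normB _ _) _; rewrite normrM (ger0_norm wl0).
      have : `|v i 0| * w a l 0 <= `|v i 0| by rewrite ler_piMr.
      by have := u4X l; lra.
    have zv : (z k 0)%:~R = (invmx P *m v) k 0 by rewrite mulKmx // mxE.
    have zb : `|(z k 0)%:~R| <= b * X :> R.
      rewrite zv /b -!mulrA; apply: entry_le => //; first by rewrite mulr_ge0 ?ltW.
      by move=> k' l'; have [] := Pb k' l'.
    rewrite -(gez0_abs (normr_ge0 (z k 0))) lez_nat.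
    rewrite truncn_ge_nat ?mulr_ge0 ?(ltW Xp) //.
    by apply: le_trans zb; rewrite natr_absz normr_id intr_norm.
  rewrite /N -zss cardE -(size_map z); apply: uniq_leq_size.
    rewrite map_inj_in_uniq ?enum_uniq // => a1 a2.
    rewrite !mem_enum => /zP[_ [q1 X1 _]] /zP[_ [q2 X2 _]] zz.
    apply: (winj a1 a2 (P *m map_mx intr (z a1))) => //; last by rewrite zz.
    by move: X1; rewrite shearE !mxE w0 mulr0 addr0.
  by move=> _ /mapP[a + ->]; rewrite mem_enum => /zP[].
have := sum_measure_le mu mF (mK M') FK FN.
have muEfin : mu E \is a fin_num.
  rewrite ge0_fin_numE //; apply: le_lt_trans (finK M).
  by apply: le_measure; rewrite ?inE //; exact: subIsetl.
under eq_bigr do rewrite muF.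
rewrite -(fineK muEfin); set e := fine (mu E).
rewrite sumEFin mE -EFinM !lee_fin sumr_const => H.
have I0 : e * (`|\det A| * X ^+ n.+1) <= D * X ^+ n.+1 * m * (2 * r) ^+ n.+1.
  apply: le_trans (_ : e * ((2 * r) ^+ n.+1 * #|I|%:R) <= _).
    by rewrite ler_wpM2l // fine_ge0.
  rewrite mulrCA mulrC ler_wpM2r ?exprn_ge0 ?mulr_ge0 ?(ltW r0) //.
  rewrite mulr_natr; have {}H : e *+ #|I| <= N%:R * m by exact: H.
  by apply: (le_trans H); rewrite ler_wpM2r.
rewrite ler_pdivlMr ?normr_gt0 -?unitfE -?unitmxE //.
have Xn0 : 0 < X ^+ n.+1 by rewrite exprn_gt0.
rewrite -(ler_pM2r Xn0) -[leLHS]mulrA; apply: le_trans I0 _.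
by rewrite le_eqVlt; apply/orP; left; apply/eqP; set u := X ^+ _; set v := _ ^+ n.+1; ring.
Qed.

(** * Almost every lattice escapes *)

Lemma dyadic_shell (R : realType) (s e : R) (N : nat) :
  e < s -> s <= 2 ^+ N * e ->
  exists2 k, (k < N)%N & 2 ^+ k * e < s <= 2 * (2 ^+ k * e).
Proof.
elim: N => [|N IH] es; first by rewrite expr0 mul1r leNgt es.
have [/(IH es) [k kN kP] _|sN] := leP s (2 ^+ N * e).
  by exists k => //; exact: ltnW.
by rewrite exprS -mulrA => sN1; exists N; rewrite ?ltnSn ?sN.
Qed.

Lemma ltr_expn2 (R : realType) (x : R) : exists b : nat, x <= 2 ^+ b.
Proof.
exists (Num.truncn x).+1; apply/ltW/(lt_le_trans (truncnS_gt x)).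
by rewrite -natrX ler_nat ltnW // ltn_expl.
Qed.

Lemma iterate_lower_bound (R : realType) (n : nat) (B : 'M[R]_n.+1) :
  B \in unitmx -> exists b : nat, forall j v s, 0 <= s ->
  (forall k, `|(B ^+ j *m v) k (0 : 'I_1)| <= s) ->
  forall k, `|v k 0| <= 2 ^+ (b * j) * s.
Proof.
move=> uB; pose M := \sum_k \sum_l `|invmx B k l|.
have BM k l : `|invmx B k l| <= M.
  rewrite /M (bigD1 k) //= (bigD1 l) //= -addrA lerDl addr_ge0 //.
    by apply: sumr_ge0.
  by apply: sumr_ge0 => i _; apply: sumr_ge0.
have [b bM] := ltr_expn2 (n.+1%:R * M).
exists b; elim=> [|j IH] v s s0 vs k.
  by have := vs k; rewrite expr0 mul1mx muln0 mul1r.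
have vs' : forall k, `|(B *m v) k 0| <= 2 ^+ (b * j) * s.
  by apply: IH => // l; have := vs l; rewrite exprSr -mulmxA.
have vE : v = invmx B *m (B *m v) by rewrite mulKmx.
rewrite {}vE; apply: le_trans (entry_le k _ BM vs') _.
  by rewrite mulr_ge0 // exprn_ge0.
rewrite mulnS exprD -!mulrA mulrA ler_wpM2r // mulr_ge0 // exprn_ge0 //.
Qed.

Lemma bernoulli_ineq (R : realType) (x : R) (j : nat) :
  0 <= x -> 1 + j%:R * x <= (1 + x) ^+ j.
Proof.
move=> x0; elim: j => [|j IH]; first by rewrite mul0r addr0 expr0.
have x10 : 0 <= 1 + x by rewrite addr_ge0.
rewrite exprS; apply: le_trans (ler_wpM2l x10 IH).
rewrite -natr1 -subr_ge0 (_ : _ - _ = j%:R * x ^+ 2); last by ring.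
by rewrite mulr_ge0 // exprn_ge0.
Qed.

(** Half of the exponential decay absorbs the linear factor: it is at most a
    constant times sqrt delta ^ j. *)
Lemma linear_geometric_summable (R : realType) (C delta : R) (a b : nat) :
  0 <= C -> 1 < delta ->
  (\sum_(j <oo) ((b * j + a)%:R * (C / delta ^+ j))%:E < +oo)%E.
Proof.
move=> C0 d1; pose h := Num.sqrt delta.
have h1 : 1 < h by rewrite -sqrtr1 ltr_sqrt // (lt_trans ltr01).
have h0 : 0 < h by apply: lt_trans h1.
have hh : h ^+ 2 = delta by rewrite sqr_sqrtr // ltW // (lt_trans ltr01).
have h10 : 0 < h - 1 by rewrite subr_gt0.
pose D : R := b%:R / (h - 1) + a%:R.
have D0 : 0 <= D by rewrite addr_ge0 // divr_ge0 // ltW.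
have abD j : (b * j + a)%:R <= D * h ^+ j.
  rewrite natrD natrM mulrDl lerD //; last first.
    by rewrite ler_peMr // exprn_ege1 // ltW.
  rewrite -mulrA ler_wpM2l // ler_pdivlMl // mulrC.
  by have := bernoulli_ineq j (ltW h10); rewrite [1 + (h - 1)]addrC subrK; lra.
apply: (@le_lt_trans _ _ (D * C * (1 - h^-1)^-1)%:E); last exact: ltry.
apply: lime_le.
  apply: is_cvg_nneseries => j _ _; rewrite lee_fin.
  by rewrite mulr_ge0 // divr_ge0 // exprn_ge0 // ltW // (lt_trans ltr01).
apply: nearW => N; rewrite sumEFin lee_fin.
apply: le_trans (@geometric_le_lim R N (D * C) h^-1 _ _ _); first 1 last.
- exact: mulr_ge0.
- by rewrite invr_gt0.
- by rewrite ger0_norm ?invr_ge0 ?ltW // invf_lt1.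
apply: ler_sum => j _; rewrite /geometric /=.
have hj : 0 < h ^+ j by rewrite exprn_gt0.
have -> : delta ^+ j = (h ^+ j) ^+ 2 by rewrite -hh -!exprM mulnC.
rewrite mulrA ler_pdivrMr ?exprn_gt0 // [leRHS](_ : _ = D * h ^+ j * C).
  by rewrite ler_wpM2r.
by rewrite exprVn; field; rewrite gt_eqF.
Qed.

Lemma max_entry (R : realType) (n : nat) (v : 'cV[R]_n.+1) :
  exists i, forall k, `|v k 0| <= `|v i 0|.
Proof.
pose i := [arg max_(i > (ord0 : 'I_n.+1)) `|v i 0|]%O.
exists i => k; rewrite /i; case: arg_maxP => //= i' _; exact.
Qed.

(** A short nonzero vector has a largest coordinate between a fixed lower bound
    and an exponential upper bound in j, so O(j) dyadic shells cover the event
    that the lattice has a nonzero vector shortened by [B ^+ j]. *)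
Lemma shell_cover (R : realType) (n : nat) (B : 'M[R]_n.+1) (M : nat) (r : R) :
  B \in unitmx -> 0 < r -> exists (e : R) (a b : nat), 0 < e /\
  forall P : 'M[R]_n.+1, P \in unitmx ->
  (forall k l, `|invmx P k l| <= M%:R) ->
  forall j v, lattice_of P v -> v != 0 -> nsq (B ^+ j *m v) < r ^+ 2 ->
  exists i k, (k < b * j + a)%N /\ thin_shell (B ^+ j) i r (2 ^+ k * e) v.
Proof.
move=> uB r0; have [b bP] := iterate_lower_bound uB.
(* Integrality of the coordinates gives entries at least 2 e; the factor 2 makes
   the first dyadic inequality strict. *)
pose e : R := (2 * (n.+1%:R * M.+1%:R))^-1.
have e0 : 0 < e by rewrite invr_gt0 !mulr_gt0.
have [a ra] := ltr_expn2 (r / e).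
exists e, a, b; split=> // P uP PM j v [z _ zv] v0 vr.
have [i vi] := max_entry v; exists i.
have vie : e < `|v i 0|.
  have [k zk] : exists k, z k 0 != 0.
    apply: contrapT => /forallNP z0; move/eqP: v0; apply.
    rewrite -zv (_ : z = 0) ?map_mx0 ?mulmx0 //; apply/colP => k.
    by rewrite mxE; apply/eqP/negPn/negP/z0.
  have zk1 : 1 <= `|(z k 0)%:~R : R|.
    by rewrite -intr_norm ler1z -gtz0_ge1 normr_gt0.
  have zE : (z k 0)%:~R = (invmx P *m v) k 0 by rewrite -zv mulKmx // mxE.
  have zb := entry_le k (normr_ge0 (v i 0)) PM vi.
  rewrite zE in zk1; have := le_trans zk1 zb.
  have vi0 : 0 <= `|v i 0| by [].
  have nM : 0 < n.+1%:R * M.+1%:R :> R by rewrite mulr_gt0.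
  rewrite mulrA => H.
  have {}H : 1 <= n.+1%:R * M.+1%:R * `|v i 0|.
    by apply: le_trans H _; rewrite ler_wpM2r // ler_wpM2l // ler_nat.
  rewrite /e -div1r ltr_pdivrMr ?mulr_gt0 //.
  by rewrite [ltRHS](_ : _ = 2 * (n.+1%:R * M.+1%:R * `|v i 0|)); [lra|ring].
have vib : `|v i 0| <= 2 ^+ (b * j + a) * e.
  apply: le_trans (bP j v r (ltW r0) _ i) _.
    move=> k; rewrite -(ler_pXn2r (n := 2)) ?nnegrE ?(ltW r0) //.
    by rewrite real_normK ?num_real //; exact/ltW/(le_lt_trans (sqr_le_nsq _ _)).
  by rewrite exprD -mulrA ler_wpM2l ?exprn_ge0 // -ler_pdivrMr.
have [k kN /andP[ek ke]] := dyadic_shell vie vib.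
exists k; split=> //; split=> // l; apply: le_lt_trans (vi l) _.
apply: le_lt_trans ke _; rewrite ltr_pM2r ?ltr_nat //.
by rewrite mulr_gt0 // exprn_gt0.
Qed.

(** Each of the O(j) shells contributes O(|det B| ^ -j), which is summable, so by
    Borel-Cantelli almost every lattice has only finitely many j for which some
    nonzero vector is made short. *)
Lemma ae_escapes (R : realType) (n : nat) d (T : measurableType d)
    (mu : {measure set T -> \bar R}) (Lam : T -> set 'cV[R]_n.+1)
    (K : nat -> set T) (B : 'M[R]_n.+1) :
  lattice_flow mu Lam K -> B \in unitmx -> 1 < `|\det B| ->
  {ae mu, forall x, escapes B (Lam x)}.
Proof.
move=> fl uB dB; have [mK _ coverK basisK hitsT _] := fl.
pose bad M q := [set x | K M x /\ ~ exists J : nat, forall j, (J <= j)%N ->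
  forall v, Lam x v -> v != 0 -> q.+1%:R ^+ 2 <= nsq (B ^+ j *m v)].
have badneg M q : mu.-negligible (bad M q).
  have r0 : 0 < q.+1%:R :> R by [].
  have [e [a [b [e0 shellP]]]] := shell_cover M uB r0.
  have [C C0 CP] := thin_shell_measure M fl r0 e0.
  (* m encodes the pair of a dyadic exponent and a coordinate index *)
  pose F j m := K M `&` [set x | Lam x `&`
    thin_shell (B ^+ j) (inord (m %% n.+1)) q.+1%:R (2 ^+ (m %/ n.+1) * e) !=set0].
  have mF j m : measurable (F j m).
    by apply: measurableI => //; exact/hitsT/open_thin_shell.
  pose N j := ((b * j + a) * n.+1)%N.
  pose E j := \big[setU/set0]_(m < N j) F j m.
  have mE j : measurable (E j) by apply: bigsetU_measurable => m _.
  exists (lim_sup_set E); split.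
  - by apply: bigcap_measurable => // i _; exact: bigcup_measurable.
  - apply: lim_sup_set_cvg0 => //.
    apply: le_lt_trans (linear_geometric_summable a b (_ : 0 <= n.+1%:R * C) dB).
      apply: lee_nneseries => // j _.
      apply: le_trans (Boole_inequality mu _) _ => //.
      apply: le_trans (_ : \sum_(m < N j) (C / `|\det (B ^+ j)|)%:E <= _)%E.
        apply: lee_sum => m _; apply: CP; first exact: unitmx_exp.
        by rewrite ler_peMl ?(ltW e0) // exprn_ege1 // ler1n.
      rewrite sumEFin sumr_const card_ord lee_fin.
      rewrite -[leLHS]mulr_natl /N natrM.
      have -> : \det (B ^+ j) = \det B ^+ j := det_expz j%:Z uB.
      by rewrite normrX -!mulrA.
    by rewrite mulr_ge0.
  - move=> x [Kx nJ] J _; apply: contrapT => nE; apply: nJ; exists J => j Jj v Lv v0.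
    rewrite leNgt; apply/negP => vr; apply: nE; exists j => //.
    have [P [uP LP Pb]] := basisK _ _ Kx.
    have [||i [k [kN sv]]] := shellP P uP _ j v _ v0 vr.
    + by move=> k l; have [] := Pb k l.
    + by rewrite -LP.
    rewrite /E -bigcup_mkord; exists (k * n.+1 + i)%N => /=.
      rewrite /N; apply: leq_trans (_ : k.+1 * n.+1 <= _)%N.
        by rewrite mulSn addnC ltn_add2r.
      by rewrite leq_mul2r kN orbT.
    split=> //; exists v; split => //=.
    rewrite modnMDl modn_small // inord_val divnMDl // divn_small ?addn0 //.
apply: (negligibleS _ (negligible_bigcup (fun M => negligible_bigcup (badneg M)))).
move=> x /= nesc; have [M KM] := coverK x; exists M => //.
apply: contrapT => nbad; apply: nesc => r r0.
have [J JP] : exists J : nat, forall j, (J <= j)%N -> forall v, Lam x v -> v != 0 ->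
    (Num.truncn r).+1%:R ^+ 2 <= nsq (B ^+ j *m v).
  apply: contrapT => nJ; apply: nbad; exists (Num.truncn r) => //.
exists J => j Jj v Lv v0; apply: le_trans (JP j Jj v Lv v0).
rewrite ler_pXn2r ?nnegrE ?(ltW r0) //; exact/ltW/truncnS_gt.
Qed.

(** * Dual lattices and unimodular actions *)

(** Defined from the point set, because an element of the space of lattices
    comes without a basis. *)
Definition dual_lattice (R : realType) (n : nat) (G : set 'cV[R]_n.+1) :
    set 'cV[R]_n.+1 :=
  [set y | forall x, G x -> exists m : int, dotp x y = m%:~R].

Lemma dual_lattice_of (R : realType) (n : nat) (P : 'M[R]_n.+1) :
  P \in unitmx -> dual_lattice (lattice_of P) = lattice_of (invmx P)^T.
Proof.
move=> uP; apply/seteqP; split=> y.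
  move=> yP; have /choice [f fP] : forall k : 'I_n.+1, exists m : int,
      dotp (P *m delta_mx k 0) y = m%:~R.
    by move=> k; apply: yP; exists (delta_mx k 0) => //; rewrite map_delta_mx.
  exists (\col_k f k) => //.
  have -> : map_mx intr (\col_k f k) = P^T *m y.
    apply/colP => k; rewrite !mxE -fP /dotp trmx_mul trmx_delta -mulmxA -rowE.
    by rewrite !mxE.
  by rewrite trmx_inv mulKmx // unitmx_tr.
move=> [w _ <-] _ [z _ <-]; exists ((z^T *m w) 0 0).
rewrite /dotp trmx_mul -mulmxA [P^T *m _]mulmxA -trmx_mul mulVmx // trmx1 mul1mx.
by rewrite map_trmx -map_mxM mxE.
Qed.

Lemma lattice_of_mul (R : realType) (n : nat) (h P : 'M[R]_n.+1) :
  lattice_of (h *m P) = [set h *m x | x in lattice_of P].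
Proof.
rewrite /lattice_of image_comp; congr (_ @` _).
by apply/funext => z /=; rewrite mulmxA.
Qed.

Lemma delta_mul0 (R : realType) (n : nat) (i : 'I_n.+1) (w : 'cV[R]_n.+1) :
  w i 0 = 0 -> (delta_mx 0 i : 'rV[R]_n.+1) *m w = 0.
Proof.
by move=> w0; rewrite -rowE; apply/matrixP => k l; rewrite !mxE !ord1.
Qed.

Lemma shearD (R : realType) (n : nat) (i : 'I_n.+1) (w : 'cV[R]_n.+1) :
  w i 0 = 0 -> shear i (- w) *m shear i w = 1%:M.
Proof.
move=> w0; rewrite /shear mulmxDl mul1mx !mulNmx mulmxDr mulmx1.
by rewrite -mulmxA [delta_mx _ _ *m _]mulmxA delta_mul0 // mul0mx mulmx0 addr0 addrK.
Qed.

Lemma det_shear (R : realType) (n : nat) (i : 'I_n.+1) (w : 'cV[R]_n.+1) :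
  w i 0 = 0 -> \det (shear i w) = 1.
Proof.
move=> w0; pose e : 'rV[R]_n.+1 := delta_mx 0 i.
(* Sylvester's identity det (1 + w e) = det (1 + e w), from two factorizations
   of one block matrix *)
have E : block_mx 1%:M 0 w 1%:M *m block_mx 1%:M (- e) 0 (shear i w) =
         block_mx 1%:M (- e) 0 1%:M *m block_mx 1%:M 0 w 1%:M.
  rewrite !mulmx_block !(mul1mx, mulmx1, mul0mx, mulmx0, addr0, add0r) mulNmx.
  by rewrite delta_mul0 // oppr0 addr0 mulmxN /shear addrC addrK.
have := congr1 determinant E.
by rewrite !det_mulmx !det_lblock !det_ublock !det1 !mul1r.
Qed.

Definition bounded_basis (R : realType) (n : nat) (M : R) (Q : 'M[R]_n.+1) :=
  forall k l, `|Q k l| < M /\ `|invmx Q k l| < M.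

Lemma bounded_basis_tr (R : realType) (n : nat) (M : R) (Q : 'M[R]_n.+1) :
  bounded_basis M Q -> bounded_basis M (invmx Q)^T.
Proof.
move=> bQ k l; have [Q1 Q2] := bQ l k.
by split; [rewrite mxE|rewrite trmx_inv invmxK mxE].
Qed.

Lemma invmxM (R : realType) (n : nat) (P Q : 'M[R]_n.+1) :
  P \in unitmx -> Q \in unitmx -> invmx (P *m Q) = invmx Q *m invmx P.
Proof.
move=> uP uQ; have uPQ : P *m Q \in unitmx by rewrite unitmx_mul uP uQ.
apply: (can_inj (mulKmx uPQ)).
by rewrite mulmxV // mulmxA -[_ *m Q *m _]mulmxA mulmxV // mulmx1 mulmxV.
Qed.

Lemma invmx_eq (R : realType) (n : nat) (P Q : 'M[R]_n.+1) :
  P *m Q = 1%:M -> invmx P = Q.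
Proof.
by move=> PQ; have [uP _] := mulmx1_unit PQ; rewrite -[LHS]mulmx1 -PQ mulKmx.
Qed.

Lemma bounded_basis_shear (R : realType) (n : nat) (M : nat) (Q : 'M[R]_n.+1) i
    (w : 'cV[R]_n.+1) : Q \in unitmx ->
  w i 0 = 0 -> (forall k, `|w k 0| <= 1) ->
  bounded_basis M%:R Q -> bounded_basis (n.+2 * M)%:R (shear i w *m Q).
Proof.
move=> uQ w0 w1 bQ k l.
have M0 : 0 < M%:R :> R by have [+ _] := bQ k l; apply: le_lt_trans.
have SS : shear i w *m shear i (- w) = 1%:M.
  by rewrite -{1}[w]opprK shearD // mxE w0 oppr0.
have [uS _] := mulmx1_unit SS.
rewrite natrM [n.+2%:R]mulrSr mulrDl mul1r; split.
  have -> : (shear i w *m Q) k l = Q k l + w k 0 * Q i l.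
    by rewrite mulmxDl mul1mx -mulmxA -rowE mxE; congr (_ + _);
      rewrite mxE big_ord1 [row _ _ _ _]mxE.
  apply: le_lt_trans (ler_normD _ _) _; rewrite addrC.
  apply: ler_ltD; last by have [] := bQ k l.
  rewrite normrM; apply: le_trans (_ : 1 * M%:R <= _).
    by apply: ler_pM => //; have [/ltW] := bQ i l.
  by rewrite ler_wpM2r ?(ltW M0) // ler1n.
rewrite invmxM // (invmx_eq SS).
have -> : (invmx Q *m shear i (- w)) k l =
    invmx Q k l - (invmx Q *m w) k 0 * (i == l)%:R.
  rewrite mulmxDr mulmx1 mulNmx mulmxN mulmxA !mxE big_ord1 !mxE eqxx /=.
  by rewrite eq_sym.
apply: le_lt_trans (ler_normB _ _) _; rewrite addrC.
apply: ler_ltD; last by have [] := bQ k l.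
rewrite normrM; apply: le_trans (_ : (n.+1%:R * (M%:R * 1)) * 1 <= _).
  apply: ler_pM => //; last by rewrite normr_nat; case: (_ == _).
  by apply: entry_le => // k' l'; have [_ /ltW] := bQ k' l'.
by rewrite !mulr1.
Qed.

(** One action of SL gives a [lattice_flow] for the lattices and one for their
    duals, on which h acts as its inverse transpose. The last clause is phrased
    through bases because membership in K M may only assert that some bounded
    basis exists. *)
Record unimodular_action (R : realType) (n : nat) d (T : measurableType d)
    (mu : {measure set T -> \bar R}) (Lam : T -> set 'cV[R]_n.+1)
    (K : nat -> set T) : Prop := UnimodularAction {
  act_measurable : forall M, measurable (K M);
  act_finite : forall M, (mu (K M) < +oo)%E;
  act_cover : forall x, exists M, K M x;
  act_basis : forall M x, K M x -> exists P : 'M[R]_n.+1,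
    [/\ P \in unitmx, Lam x = lattice_of P & bounded_basis M%:R P];
  act_hits : forall U : set 'cV[R]_n.+1, open U ->
    measurable [set x | Lam x `&` U !=set0];
  act_dual_hits : forall U : set 'cV[R]_n.+1, open U ->
    measurable [set x | dual_lattice (Lam x) `&` U !=set0];
  act_SL : forall h : 'M[R]_n.+1, \det h = 1 -> exists f : T -> T,
    [/\ forall A, measurable A -> measurable (f @^-1` A),
        forall A, measurable A -> mu (f @^-1` A) = mu A,
        forall x, Lam (f x) = [set h *m v | v in Lam x] &
        forall M M' : nat,
          (forall Q, Q \in unitmx -> bounded_basis M%:R Q ->
             bounded_basis M'%:R (invmx h *m Q)) ->
          forall x, K M (f x) -> K M' x] }.

Lemma action_flow (R : realType) (n : nat) d (T : measurableType d)
    (mu : {measure set T -> \bar R}) (Lam : T -> set 'cV[R]_n.+1)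
    (K : nat -> set T) :
  unimodular_action mu Lam K -> lattice_flow mu Lam K.
Proof.
move=> [mK finK coverK basisK hitsT _ actT]; split => //.
  move=> M x /basisK [P [uP LP bP]]; exists P; split=> // k l.
  by have [/ltW ? /ltW ?] := bP k l.
move=> i w w0 w01; have [f [mf pf Lf Kf]] := actT _ (det_shear w0).
exists f; split=> // M; apply: Kf => Q uQ bQ.
rewrite (_ : invmx (shear i w) = shear i (- w)).
  apply: bounded_basis_shear => //; first by rewrite mxE w0 oppr0.
  by move=> k; rewrite mxE normrN; have /andP[w0' w1] := w01 k; rewrite ger0_norm.
by apply: invmx_eq; rewrite -{1}[w]opprK shearD // mxE w0 oppr0.
Qed.

(** A shear of the dual lattice is the effect of the inverse transposed shear on
    the lattice. *)
Lemma action_dual_flow (R : realType) (n : nat) d (T : measurableType d)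
    (mu : {measure set T -> \bar R}) (Lam : T -> set 'cV[R]_n.+1)
    (K : nat -> set T) :
  unimodular_action mu Lam K -> lattice_flow mu (fun x => dual_lattice (Lam x)) K.
Proof.
move=> [mK finK coverK basisK _ hitsT actT]; split => //.
  move=> M x /basisK [P [uP LP bP]]; exists (invmx P)^T; split.
  - by rewrite unitmx_tr unitmx_inv.
  - by rewrite /= LP dual_lattice_of.
  - by move=> k l; have [/ltW ? /ltW ?] := bounded_basis_tr bP k l.
move=> i w w0 w01; have SS := shearD w0.
have [uSN uS] := mulmx1_unit SS.
pose h := (shear i (- w))^T.
have deth : \det h = 1 by rewrite det_tr det_shear // mxE w0 oppr0.
have uh : h \in unitmx by rewrite unitmx_tr.
have ih : invmx h = (shear i w)^T by rewrite /h -trmx_inv (invmx_eq SS).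
have [f [mf pf Lf Kf]] := actT _ deth.
exists f; split=> //.
  move=> x; have [M /basisK [P [uP LP _]]] := coverK x.
  rewrite /= Lf LP -lattice_of_mul !dual_lattice_of ?unitmx_mul ?uh //.
  by rewrite -lattice_of_mul invmxM // ih trmx_mul trmxK.
move=> M; apply: Kf => Q uQ bQ; rewrite ih.
have uQ' : (invmx Q)^T \in unitmx by rewrite unitmx_tr unitmx_inv.
have := @bounded_basis_shear R n M _ i (- w) uQ' _ _ (bounded_basis_tr bQ).
rewrite mxE w0 oppr0 => /(_ erefl); have wN k : `|(- w) k 0| <= 1.
  by rewrite mxE normrN; have /andP[w0' w1] := w01 k; rewrite ger0_norm.
move=> /(_ wN) /bounded_basis_tr.
rewrite invmxM // (invmx_eq SS) trmx_inv invmxK trmx_mul trmxK //.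
Qed.

Lemma action_ae_escapes (R : realType) (n : nat) d (T : measurableType d)
    (mu : {measure set T -> \bar R}) (Lam : T -> set 'cV[R]_n.+1)
    (K : nat -> set T) (B : 'M[R]_n.+1) :
  unimodular_action mu Lam K -> B \in unitmx -> 1 < `|\det B| ->
  {ae mu, forall x, escapes B (Lam x) /\ escapes B^T (dual_lattice (Lam x))}.
Proof.
move=> act uB dB.
have e1 := ae_escapes (action_flow act) uB dB.
have uBT : B^T \in unitmx by rewrite unitmx_tr.
have e2 := ae_escapes (action_dual_flow act) uBT.
rewrite det_tr in e2; have {}e2 := e2 dB.
by apply: filterS2 e1 e2.
Qed.

(** * The space of unimodular lattices *)

Lemma open_bounded_basis (R : realType) (n : nat) (T : topologicalType)
    (f : T -> 'M[R]_n.+1) (M : R) :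
  continuous f -> (forall x, f x \in unitmx) ->
  open [set x | bounded_basis M (f x)].
Proof.
move=> cf uf; have cif := continuous_invmx cf uf.
have -> : [set x | bounded_basis M (f x)] =
    [set x | forall k l, `|f x k l| < M] `&`
    [set x | forall k l, `|invmx (f x) k l| < M].
  apply/seteqP; split=> x /=; last by move=> [b1 b2] k l; split.
  by move=> bx; split=> k l; have [] := bx k l.
have oP (g : T -> 'M[R]_n.+1) :
    continuous g -> open [set x | forall k l, `|g x k l| < M].
  move=> cg; apply: (open_forall (U := fun k x => forall l, _)) => k.
  apply: open_forall => l; apply: open_lt_cont.
    by apply: continuous_normr; exact: continuous_coord.
  by move=> x; exact: cst_continuous.
by apply: openI; exact: oP.
Qed.

Lemma measurable_continuous (T T' : ptopologicalType) (f : T -> T') :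
  continuous f -> forall A : set (borel T'), measurable A ->
  measurable (f @^-1` A : set (borel T)).
Proof.
move=> /continuousP cf A mA.
have mf : measurable_fun [set: borel T] (f : borel T -> borel T').
  apply: (@measurability _ _ (borel T) (borel T') setT f (@open T')) => //.
  move=> _ [U oU <-]; rewrite setTI; apply: sub_sigma_algebra; exact: cf.
by rewrite -[X in measurable X]setTI; apply: mf.
Qed.

Lemma open_measurable_borel (T : ptopologicalType) (U : set T) :
  open U -> measurable (U : set (borel T)).
Proof. by move=> oU; apply: sub_sigma_algebra. Qed.

Lemma exists_entry_bound (R : realType) (n : nat) (P : 'M[R]_n.+1) :
  exists M : nat, bounded_basis M%:R P.
Proof.
pose s (Q : 'M[R]_n.+1) := \sum_k \sum_l `|Q k l|.
have sP (Q : 'M[R]_n.+1) k l : `|Q k l| <= s Q.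
  rewrite /s (bigD1 k) //= (bigD1 l) //= -addrA lerDl addr_ge0 //.
    by apply: sumr_ge0.
  by apply: sumr_ge0 => i _; apply: sumr_ge0.
have s0 (Q : 'M[R]_n.+1) : 0 <= s Q by apply: sumr_ge0 => k _; apply: sumr_ge0.
exists (Num.truncn (s P + s (invmx P))).+1 => k l.
split; apply: le_lt_trans (truncnS_gt _).
  by apply: le_trans (sP P k l) _; rewrite lerDl.
by apply: le_trans (sP (invmx P) k l) _; rewrite lerDr.
Qed.

Lemma lattice_of_int_unit (R : realType) (n : nat) (P : 'M[R]_n.+1)
    (V : 'M[int]_n.+1) :
  V \in unitmx -> lattice_of (P *m map_mx intr V) = lattice_of P.
Proof.
move=> uV; apply/seteqP; split=> _ [z _ <-].
  by exists (V *m z) => //; rewrite map_mxM mulmxA.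
by exists (invmx V *m z) => //; rewrite -mulmxA -map_mxM mulKVmx.
Qed.

(** Changing the sign of one basis vector corrects a determinant -1. *)
Lemma SL_lattice_surj (R : realType) (n : nat) (G : Ln R n) :
  exists P : SL R n, SL_lattice P = G.
Proof.
have [P [uP GP detP]] : unimodular_lattice (\val G) by exact: (set_mem (valP G)).
suff [Q [detQ GQ]] : exists Q : 'M[R]_n.+1, \det Q = 1 /\ \val G = lattice_of Q.
  by exists (exist _ Q (mem_set detQ)); apply: val_inj.
have [P1|P1] : \det P = 1 \/ \det P = -1.
- by have [P0|P0] := leP 0 (\det P); [left|right];
    move: detP; rewrite ?(ger0_norm P0) // (ltr0_norm P0) => /eqP;
    rewrite eqr_oppLR => /eqP.
- by exists P.
pose V : 'M[int]_n.+1 := diag_mx (\row_j if j == 0 then -1 else 1).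
have detV : \det V = -1.
  rewrite det_diag (bigD1 0) //= big1 ?mulr1 ?mxE // => j j0.
  by rewrite mxE (negPf j0).
exists (P *m map_mx intr V); split.
  by rewrite det_mulmx P1 det_map_mx detV rmorphN1 mulrNN mulr1.
by rewrite lattice_of_int_unit // unitmxE detV.
Qed.

Lemma SL_unit (R : realType) (n : nat) (P : SL R n) : \val P \in unitmx.
Proof. by rewrite unitmxE (set_mem (valP P)) unitr1. Qed.

Lemma continuous_SL_val (R : realType) (n : nat) :
  continuous (fun P : SL R n => \val P).
Proof. exact: initial_continuous. Qed.

Definition Ln_bounded (R : realType) (n : nat) (M : nat) : set (Ln R n) :=
  [set G | exists2 Q : SL R n, bounded_basis M%:R (\val Q) & SL_lattice Q = G].

(** The preimage in SL is the union of the translates of an open set by the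
    stabilizer of the integer lattice. *)
Lemma Ln_bounded_open (R : realType) (n : nat) (M : nat) :
  open (@Ln_bounded R n M).
Proof.
rewrite [open _]/(Ln_open _) /Ln_open.
pose C := [set g : 'M[R]_n.+1 | \det g = 1 /\ lattice_of g = lattice_of 1%:M].
have -> : @SL_lattice R n @^-1` (@Ln_bounded R n M) =
    \bigcup_(g in C) [set P | bounded_basis M%:R (\val P *m g)].
  apply/seteqP; split=> P /=.
    move=> [Q bQ /(congr1 val) /= QP].
    exists (invmx (\val P) *m \val Q); last by rewrite /= mulKVmx ?SL_unit.
    split.
      rewrite det_mulmx det_inv.
      by rewrite (set_mem (valP P)) (set_mem (valP Q)) invr1 mulr1.
    by rewrite -(mulVmx (SL_unit P)) !lattice_of_mul QP.
  move=> [g [detg Lg] bg].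
  have detPg : \det (\val P *m g) = 1.
    by rewrite det_mulmx detg (set_mem (valP P)) mulr1.
  exists (exist _ (\val P *m g) (mem_set detPg)) => //.
  apply: val_inj; rewrite /= -[in RHS](mulmx1 (\val P)).
  by rewrite !lattice_of_mul Lg.
apply: bigcup_open => g [detg _]; apply: open_bounded_basis.
  by apply: continuous_mulmx; [exact: continuous_SL_val|move=> P; exact: cst_continuous].
by move=> P; rewrite unitmx_mul SL_unit unitmxE detg unitr1.
Qed.

Lemma Ln_hits_open (R : realType) (n : nat) (U : set 'cV[R]_n.+1) :
  open U -> open [set G : Ln R n | \val G `&` U !=set0].
Proof.
move=> oU; rewrite [open _]/(Ln_open _) /Ln_open.
rewrite (_ : _ @^-1` _ = \bigcup_(z in [set: 'cV[int]_n.+1])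
    [set P : SL R n | U (\val P *m map_mx intr z)]).
  apply: bigcup_open => z _; apply: open_comp => // P _.
  apply: (@continuous_mulmx _ _ _ _ _ (fun P : SL R n => \val P)
            (fun=> map_mx intr z)); first exact: continuous_SL_val.
  by move=> Q; exact: cst_continuous.
apply/seteqP; split=> P /=.
  by move=> [_ [[z _ <-] Uz]]; exists z.
by move=> [z _ Uz]; exists (\val P *m map_mx intr z); split => //; exists z.
Qed.

Lemma Ln_dual_hits_open (R : realType) (n : nat) (U : set 'cV[R]_n.+1) :
  open U -> open [set G : Ln R n | dual_lattice (\val G) `&` U !=set0].
Proof.
move=> oU; rewrite [open _]/(Ln_open _) /Ln_open.
rewrite (_ : _ @^-1` _ = \bigcup_(z in [set: 'cV[int]_n.+1])
    [set P : SL R n | U ((invmx (\val P))^T *m map_mx intr z)]).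
  apply: bigcup_open => z _; apply: open_comp => // P _.
  apply: (@continuous_mulmx _ _ _ _ _ (fun P : SL R n => (invmx (\val P))^T)
            (fun=> map_mx intr z)); last by move=> Q; exact: cst_continuous.
  apply: continuous_trmx; apply: continuous_invmx; last exact: SL_unit.
  exact: continuous_SL_val.
apply/seteqP; split=> P /=; rewrite dual_lattice_of ?SL_unit //.
  by move=> [_ [[z _ <-] Uz]]; exists z.
by move=> [z _ Uz]; eexists; split; [exists z|exact: Uz].
Qed.

Lemma continuous_Ln_act (R : realType) (n : nat) (g : SL R n) :
  continuous (Ln_act g : Ln R n -> Ln R n).
Proof.
apply/continuousP => U oU; rewrite [open _]/(Ln_open _) /Ln_open.
have {}oU : open (@SL_lattice R n @^-1` U) by exact: oU.
have detg (P : SL R n) : \det (\val g *m \val P) = 1.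
  by rewrite det_mulmx (set_mem (valP P)) (set_mem (valP g)) mulr1.
pose m (P : SL R n) : SL R n := exist _ (\val g *m \val P) (mem_set (detg P)).
have mE P : Ln_act g (SL_lattice P) = SL_lattice (m P).
  by apply: val_inj => /=; rewrite lattice_of_mul.
have -> : @SL_lattice R n @^-1` (Ln_act g @^-1` U) =
    m @^-1` (@SL_lattice R n @^-1` U).
  by apply/seteqP; split=> P /=; rewrite mE.
case: oU => W oW WU; exists ((fun P : 'M[R]_n.+1 => \val g *m P) @^-1` W).
  apply: open_comp => // P _; apply: continuous_mulmx => // Q; first exact: cst_continuous.
  exact.
by rewrite -WU.
Qed.

Lemma Ln_action (R : realType) (n : nat) (mu : probability (borel (Ln R n)) R) :
  SL_invariant mu ->
  unimodular_action mu (fun G : borel (Ln R n) => \val (G : Ln R n))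
    (@Ln_bounded R n).
Proof.
move=> inv; split.
- by move=> M; exact: (open_measurable_borel (@Ln_bounded_open R n M)).
- move=> M; apply: le_lt_trans (_ : (1 < +oo)%E); last exact: ltry.
  by apply: probability_le1; exact: (open_measurable_borel (@Ln_bounded_open R n M)).
- move=> G; have [P PG] := SL_lattice_surj G.
  by have [M bM] := exists_entry_bound (\val P); exists M, P.
- move=> M _ [Q bQ <-]; exists (\val Q); split=> //; exact: SL_unit.
- by move=> U oU; exact: (open_measurable_borel (Ln_hits_open oU)).
- by move=> U oU; exact: (open_measurable_borel (Ln_dual_hits_open oU)).
move=> h deth; pose g : SL R n := exist _ h (mem_set deth).
have uh : h \in unitmx := SL_unit g.
exists (Ln_act g); split.
- by apply: measurable_continuous; exact: continuous_Ln_act.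
- by move=> A mA; exact: inv.
- by [].
move=> M M' hM G [Q bQ QG].
have detQ : \det (invmx h *m \val Q) = 1.
  by rewrite det_mulmx det_inv deth (set_mem (valP Q)) invr1 mulr1.
pose Q' : SL R n := exist _ (invmx h *m \val Q) (mem_set detQ).
exists Q'; first by apply: hM => //; exact: SL_unit.
apply: val_inj; rewrite /= lattice_of_mul.
move/(congr1 val): QG => /= ->; rewrite image_comp.
rewrite (_ : _ \o _ = id) ?image_id //.
by apply/funext => v /=; rewrite mulKmx.
Qed.

(** * The action on the general linear group *)

Lemma GL_unit (R : realType) (n : nat) (g : GL R n) : \val g \in unitmx.
Proof. exact: (set_mem (valP g)). Qed.

Lemma continuous_GL_val (R : realType) (n : nat) :
  continuous (fun g : GL R n => \val g).
Proof. exact: initial_continuous. Qed.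

Lemma continuous_GL_mul (R : realType) (n : nat) (g : GL R n) :
  continuous (GL_mul g).
Proof.
apply/continuousP => _ [W oW <-].
exists ((fun P : 'M[R]_n.+1 => \val g *m P) @^-1` W) => //.
apply: open_comp => // P _; apply: continuous_mulmx => // Q; first exact: cst_continuous.
exact.
Qed.

Lemma compact_bounded_mx (R : realType) (m p : nat) (c : R) :
  compact [set Q : 'M[R]_(m, p) | forall k l, `|Q k l| <= c].
Proof.
have -> : [set Q : 'M[R]_(m, p) | forall k l, `|Q k l| <= c] =
    vec_mx @` [set v : 'rV[R]_(m * p) | forall i, `[- c, c]%classic (v ord0 i)].
  apply/seteqP; split=> [Q /= Qc|_ /= [v vc <-] k l].
    exists (mxvec Q); last exact: mxvecK.
    by move=> i; case/mxvec_indexP: i => k l; rewrite mxvecE /= in_itv /= -ler_norml.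
  by have := vc (mxvec_index k l); rewrite mxE in_itv /= -ler_norml.
apply: continuous_compact.
  apply: continuous_subspaceT; apply: continuous_mx => k l.
  under eq_fun do rewrite mxE.
  by move=> v; exact: coord_continuous.
by apply: (@rV_compact _ _ (fun=> `[- c, c]%classic)) => i; exact: segment_compact.
Qed.

(** A cluster point among matrices lies in C, hence is invertible. *)
Lemma compact_GL (R : realType) (n : nat) (C : set 'M[R]_n.+1) :
  compact C -> (forall Q, C Q -> Q \in unitmx) ->
  compact ((fun g : GL R n => \val g) @^-1` C).
Proof.
move=> cC CU F FF FC.
have [p [Cp clp]] := cC (fmap (fun g : GL R n => \val g) F) _ FC.
pose g : GL R n := exist _ p (mem_set (CU p Cp)).
exists g; split => // A D FA [U [[W oW WU] Ug UD]].
have FvA : F ((fun g : GL R n => \val g) @^-1` ((fun g : GL R n => \val g) @` A)).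
  by apply: filterS FA => a Aa; exists a.
have Wp : W p.
  have : ((fun g : GL R n => \val g) @^-1` W) g by rewrite [_ @^-1` _]WU.
  by [].
have [_ [[a Aa <-] Wa]] := clp _ W FvA (open_nbhs_nbhs (conj oW Wp)).
by exists a; split => //; apply: UD; rewrite -WU.
Qed.

Lemma det_bound (R : realType) (m : nat) (M : R) (Q : 'M[R]_m) :
  (forall k l, `|Q k l| <= M) -> `|\det Q| <= #|{: {perm 'I_m}}|%:R * M ^+ m.
Proof.
move=> QM; apply: le_trans (ler_norm_sum _ _ _) _.
rewrite -sumr_const mulr_suml; apply: ler_sum => s _.
rewrite normrM normrX normrN1 expr1n normr_prod mul1r mul1r.
rewrite -[m in leRHS]card_ord -prodr_const; apply: ler_prod => k _.
by rewrite normr_ge0 QM.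
Qed.

Definition GL_bounded (R : realType) (n : nat) (P : 'M[R]_n.+1) (M : nat) :
  set (GL R n) := [set g | bounded_basis M%:R (\val g *m P)].

Lemma continuous_GL_val_mul (R : realType) (n : nat) (P : 'M[R]_n.+1) :
  continuous (fun g : GL R n => \val g *m P).
Proof.
apply: continuous_mulmx; first exact: continuous_GL_val.
by move=> g; exact: cst_continuous.
Qed.

Lemma GL_mul_unit (R : realType) (n : nat) (P : 'M[R]_n.+1) (g : GL R n) :
  P \in unitmx -> \val g *m P \in unitmx.
Proof. by move=> uP; rewrite unitmx_mul GL_unit. Qed.

Lemma GL_bounded_open (R : realType) (n : nat) (P : 'M[R]_n.+1) (M : nat) :
  P \in unitmx -> open (GL_bounded P M).
Proof.
move=> uP; apply: open_bounded_basis => [|g]; first exact: continuous_GL_val_mul.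
exact: GL_mul_unit.
Qed.

(** A bounded inverse has bounded determinant, which keeps the determinant away
    from 0 on the set. *)
Lemma GL_bounded_compact (R : realType) (n : nat) (P : 'M[R]_n.+1) (M : nat) :
  P \in unitmx -> exists2 C : set (GL R n), compact C /\ closed C &
  GL_bounded P M `<=` C.
Proof.
move=> uP; pose D : R := #|{: {perm 'I_n.+1}}|%:R * M%:R ^+ n.+1 + 1.
have D0 : 0 < D by rewrite ltr_wpDl // mulr_ge0 // exprn_ge0.
have [M0 PM0] := exists_entry_bound P.
pose c : R := n.+1%:R * (M%:R * M0%:R).
pose C := [set Q : 'M[R]_n.+1 | forall k l, `|Q k l| <= c] `&`
  [set Q | `|\det P|^-1 * D^-1 <= `|\det Q|].
have clD : closed [set Q : 'M[R]_n.+1 | `|\det P|^-1 * D^-1 <= `|\det Q|].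
  apply: (@closed_comp _ _ (fun Q : 'M[R]_n.+1 => `|\det Q|) [set x | _ <= x]).
    by move=> Q _; apply: continuous_normr; apply: continuous_det => x; exact.
  exact: closed_ge.
have detP : 0 < `|\det P| by rewrite normr_gt0 -unitfE -unitmxE.
have CU Q : C Q -> Q \in unitmx.
  move=> [_ /= QD]; rewrite unitmxE unitfE -normr_gt0; apply: lt_le_trans QD.
  by rewrite mulr_gt0 ?invr_gt0.
have cC : compact C by apply: compact_closedI => //; exact: compact_bounded_mx.
exists ((fun g : GL R n => \val g) @^-1` C).
  split; first exact: compact_GL.
  apply: closed_comp; first by move=> g _; exact: continuous_GL_val.
  by apply: compact_closed => //; exact: (@norm_hausdorff R).
move=> g bg; split=> [k l|] /=.
  have -> : \val g = (\val g *m P) *m invmx P by rewrite mulmxK.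
  rewrite mxE; apply: le_trans (ler_norm_sum _ _ _) _.
  apply: le_trans (_ : \sum_(i < n.+1) M%:R * M0%:R <= _); last first.
    by rewrite sumr_const card_ord /c [leRHS]mulr_natl.
  apply: ler_sum => i _; rewrite normrM ler_pM //.
    by have [/ltW] := bg k i.
  by have [_ /ltW] := PM0 i l.
have gPD : `|\det (invmx (\val g *m P))| <= D.
  apply: le_trans (@det_bound _ _ M%:R _ _) _; last by rewrite /D lerDl.
  by move=> k l; have [_ /ltW] := bg k l.
move: gPD; rewrite det_inv det_mulmx normfV normrM.
have detg : 0 < `|\det (\val g)| by rewrite normr_gt0 -unitfE -unitmxE GL_unit.
rewrite invfM -ler_pdivlMr ?invr_gt0 // invrK => H.
rewrite mulrC -ler_pdivlMr ?invr_gt0 // invrK.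
by rewrite -lef_pV2 ?posrE ?mulr_gt0 ?invr_gt0 // invrK invfM -ler_pdivlMr ?invr_gt0 // invrK.
Qed.

Lemma GL_hits_open (R : realType) (n : nat) (P : 'M[R]_n.+1)
    (U : set 'cV[R]_n.+1) :
  open U -> open [set g : GL R n | lattice_of (\val g *m P) `&` U !=set0].
Proof.
move=> oU; rewrite (_ : mkset _ = \bigcup_(z in [set: 'cV[int]_n.+1])
    [set g : GL R n | U (\val g *m P *m map_mx intr z)]).
  apply: bigcup_open => z _; apply: open_comp => // g _.
  apply: (@continuous_mulmx _ _ _ _ _ (fun g : GL R n => \val g *m P)
            (fun=> map_mx intr z)); first exact: continuous_GL_val_mul.
  by move=> h; exact: cst_continuous.
apply/seteqP; split=> g /=.
  by move=> [_ [[z _ <-] Uz]]; exists z.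
by move=> [z _ Uz]; exists (\val g *m P *m map_mx intr z); split => //; exists z.
Qed.

Lemma GL_dual_hits_open (R : realType) (n : nat) (P : 'M[R]_n.+1)
    (U : set 'cV[R]_n.+1) : P \in unitmx -> open U ->
  open [set g : GL R n | dual_lattice (lattice_of (\val g *m P)) `&` U !=set0].
Proof.
move=> uP oU; rewrite (_ : mkset _ = \bigcup_(z in [set: 'cV[int]_n.+1])
    [set g : GL R n | U ((invmx (\val g *m P))^T *m map_mx intr z)]).
  apply: bigcup_open => z _; apply: open_comp => // g _.
  apply: (@continuous_mulmx _ _ _ _ _ (fun g : GL R n => (invmx (\val g *m P))^T)
            (fun=> map_mx intr z)); last by move=> h; exact: cst_continuous.
  apply: continuous_trmx; apply: continuous_invmx; first exact: continuous_GL_val_mul.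
  by move=> h; exact: GL_mul_unit.
apply/seteqP; split=> g /=; rewrite dual_lattice_of ?GL_mul_unit //.
  by move=> [_ [[z _ <-] Uz]]; exists z.
by move=> [z _ Uz]; eexists; split; [exists z|exact: Uz].
Qed.

Lemma haar_bounded_finite (R : realType) (n : nat) (P : 'M[R]_n.+1)
    (nu : {measure set (borel (GL R n)) -> \bar R}) (M : nat) :
  P \in unitmx -> haar_measure nu -> (nu (GL_bounded P M) < +oo)%E.
Proof.
move=> uP [_ finK _]; have [C [cC clC] PC] := GL_bounded_compact M uP.
apply: le_lt_trans (finK _ cC); apply: le_measure; rewrite ?inE //.
  exact: (open_measurable_borel (GL_bounded_open M uP)).
rewrite -[C]setCK; apply: measurableC.
by apply: (@open_measurable_borel (GL R n)); exact: closed_openC.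
Qed.

Lemma GL_bounded_cover (R : realType) (n : nat) (P : 'M[R]_n.+1) (g : GL R n) :
  exists M, GL_bounded P M g.
Proof. exact: exists_entry_bound. Qed.

Lemma GL_action (R : realType) (n : nat) (P : 'M[R]_n.+1)
    (nu : {measure set (borel (GL R n)) -> \bar R}) :
  P \in unitmx -> haar_measure nu ->
  unimodular_action nu
    (fun g : borel (GL R n) => lattice_of (\val (g : GL R n) *m P))
    (GL_bounded P).
Proof.
move=> uP hnu; have [_ _ inv] := hnu; split.
- by move=> M; exact: (open_measurable_borel (GL_bounded_open M uP)).
- by move=> M; exact: haar_bounded_finite.
- by move=> g; exact: GL_bounded_cover.
- by move=> M g bg; exists (\val (g : GL R n) *m P); split => //; exact: GL_mul_unit.
- by move=> U oU; exact: (open_measurable_borel (GL_hits_open P oU)).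
- by move=> U oU; exact: (open_measurable_borel (GL_dual_hits_open uP oU)).
move=> h deth; have uh : h \in unitmx by rewrite unitmxE deth unitr1.
pose k : GL R n := exist _ h (mem_set uh).
exists (GL_mul k); split.
- by apply: measurable_continuous; exact: continuous_GL_mul.
- by move=> A mA; exact: inv.
- by move=> g; rewrite -lattice_of_mul mulmxA.
move=> M M' hM g; rewrite /GL_bounded /= -mulmxA => bg.
rewrite -(mulKmx uh (\val (g : GL R n) *m P)); apply: hM => //.
by rewrite unitmx_mul uh GL_mul_unit.
Qed.

(** * Almost every matrix for a fixed lattice *)

Lemma nsq_mul_le (R : realType) (m : nat) (Q : 'M[R]_m) :
  exists2 c : R, 0 < c & forall y, nsq (Q *m y) <= c ^+ 2 * nsq y.
Proof.
pose s := \sum_k nsq (row k Q)^T.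
have s0 : 0 <= s by apply: sumr_ge0 => k _; exact: nsq_ge0.
exists (s + 1) => [|y]; first by rewrite ltr_wpDl.
apply: le_trans (_ : s * nsq y <= _); last first.
  rewrite ler_wpM2r ?nsq_ge0 //.
  by rewrite -subr_ge0 (_ : _ - _ = s * (s + 1) + 1); [rewrite addr_ge0 ?mulr_ge0 ?addr_ge0|ring].
rewrite /s mulr_suml; apply: ler_sum => k _.
apply: le_trans (Cauchy_Schwarz_nsq _ _).
by rewrite /dotp trmxK -row_mul [row _ _ _ _]mxE.
Qed.

(** Conjugation by h changes norms by bounded factors only. *)
Lemma escapes_conj (R : realType) (n : nat) (B h Q : 'M[R]_n.+1) :
  h \in unitmx -> escapes B (lattice_of (h *m Q)) ->
  escapes (invmx h *m B *m h) (lattice_of Q).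
Proof.
move=> uh escB r r0; have [c c0 hc] := nsq_mul_le h.
have [J JP] := escB (c * r) (mulr_gt0 c0 r0); exists J => j Jj v Lv v0.
have conjX : (invmx h *m B *m h) ^+ j = invmx h *m B ^+ j *m h.
  elim: (j) => [|i IH]; first by rewrite !expr0 mulmx1 mulVmx.
  rewrite !exprS IH -[LHS]/(invmx h *m B *m h *m (invmx h *m B ^+ i *m h)).
  by rewrite -!mulmxA mulKVmx // [B *m (B ^+ i *m h)]mulmxA.
rewrite conjX; have hv0 : h *m v != 0.
  by apply: contra_neq v0 => hv0; rewrite -(mulKmx uh v) hv0 mulmx0.
have hLv : lattice_of (h *m Q) (h *m v) by rewrite lattice_of_mul; exists v.
have := JP j Jj _ hLv hv0.
have := hc (invmx h *m B ^+ j *m h *m v).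
rewrite [h *m _](_ : _ = B ^+ j *m (h *m v)); last by rewrite -!mulmxA mulKVmx.
move=> /[swap] /le_trans /[apply].
by rewrite exprMn ler_pM2l // exprn_gt0.
Qed.

Definition entries_measurable (R : realType) (p q : nat) d (T : measurableType d)
    (F : T -> 'M[R]_(p, q)) :=
  forall i j, measurable_fun [set: T] (fun x => F x i j).

Lemma entries_measurable_mul (R : realType) (p q s : nat) d (T : measurableType d)
    (F : T -> 'M[R]_(p, q)) (G : T -> 'M[R]_(q, s)) :
  entries_measurable F -> entries_measurable G ->
  entries_measurable (fun x => F x *m G x).
Proof.
move=> mF mG i j; under eq_fun do rewrite mxE.
by apply: measurable_sum => k; exact: measurable_funM.
Qed.

Lemma entries_measurable_cst (R : realType) (p q : nat) d (T : measurableType d)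
    (Q : 'M[R]_(p, q)) : entries_measurable (fun _ : T => Q).
Proof. by move=> i j; exact: measurable_cst. Qed.

Lemma entries_measurable_exp (R : realType) (n : nat) d (T : measurableType d)
    (F : T -> 'M[R]_n.+1) (j : nat) :
  entries_measurable F -> entries_measurable (fun x => F x ^+ j).
Proof.
move=> mF; elim: j => [|j IH]; first exact: entries_measurable_cst.
under eq_fun do rewrite exprS.
exact: entries_measurable_mul.
Qed.

Lemma entries_measurable_tr (R : realType) (p q : nat) d (T : measurableType d)
    (F : T -> 'M[R]_(p, q)) :
  entries_measurable F -> entries_measurable (fun x => (F x)^T).
Proof. by move=> mF i j; under eq_fun do rewrite mxE; exact: mF. Qed.

Lemma continuous_borel_measurable (R : realType) (T : ptopologicalType)
    (f : T -> R) : continuous f -> measurable_fun [set: borel T] (f : borel T -> R).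
Proof.
move=> /continuousP cf; apply: (measurability _ (RGenOpens.measurableE R)) => //.
move=> _ [_ [a [b ->]] <-]; rewrite setTI; apply: open_measurable_borel.
by apply: cf; exact: interval_open.
Qed.

Lemma measurable_escapes (R : realType) (n : nat) d (T : measurableType d)
    (F : T -> 'M[R]_n.+1) (Q : 'M[R]_n.+1) :
  entries_measurable F -> measurable [set x | escapes (F x) (lattice_of Q)].
Proof.
(* z enumerates the integer vectors, with default value 0. *)
move=> mF; pose z (m : nat) : 'cV[int]_n.+1 := odflt 0 (choice.unpickle m).
pose A q j m := [set x | Q *m map_mx intr (z m) != 0 ->
  q.+1%:R ^+ 2 <= nsq (F x ^+ j *m (Q *m map_mx intr (z m)))].
have mA q j m : measurable (A q j m).
  have [z0|z0] := eqVneq (Q *m map_mx intr (z m)) 0.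
    by rewrite (_ : A q j m = setT) //; apply/seteqP; split=> x //= _; rewrite /A /= z0 eqxx.
  rewrite (_ : A q j m = [set: T] `&` [set x | q.+1%:R ^+ 2 <=
      nsq (F x ^+ j *m (Q *m map_mx intr (z m)))]).
    apply: measurable_fun_le => //.
    apply: measurable_sum => k; apply: measurable_funX.
    apply: entries_measurable_mul; first exact: entries_measurable_exp.
    exact: entries_measurable_cst.
  by rewrite setTI; apply/seteqP; split=> x //=; [apply|move=> ? _].
rewrite (_ : mkset _ = \bigcap_q \bigcup_J \bigcap_(j in [set j | (J <= j)%N])
    \bigcap_m A q j m).
  apply: bigcapT_measurable => q; apply: bigcupT_measurable => J.
  apply: bigcap_measurable; first by exists J => /=.
  by move=> j _; apply: bigcapT_measurable => m.
apply/seteqP; split=> x /=.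
  move=> esc q _; have [J JP] := esc q.+1%:R (ltr0Sn _ _).
  by exists J => // j Jj m _ z0; apply: JP => //; exists (z m).
move=> Ax r r0; have [J _ JP] := Ax (Num.truncn r) I.
exists J => j Jj _ [w _ <-] w0.
have zw : z (choice.pickle w) = w by rewrite /z choice.pickleK.
have := JP j Jj (choice.pickle w) I; rewrite /A /= zw => /(_ w0); apply: le_trans.
by rewrite ler_pXn2r ?nnegrE ?(ltW r0) //; exact/ltW/truncnS_gt.
Qed.

Definition good_pair (R : realType) (n : nat) (P B : 'M[R]_n.+1) :=
  escapes B (lattice_of P) /\ escapes B^T (lattice_of (invmx P)^T).

Lemma measurable_good_pair (R : realType) (n : nat) d (T : measurableType d)
    (F : T -> 'M[R]_n.+1) (P : 'M[R]_n.+1) :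
  entries_measurable F -> measurable [set x | good_pair P (F x)].
Proof.
move=> mF; apply: measurableI; first exact: measurable_escapes.
by apply: measurable_escapes; exact: entries_measurable_tr.
Qed.

Lemma good_pair_conj (R : realType) (n : nat) (P B g : 'M[R]_n.+1) :
  P \in unitmx -> g \in unitmx ->
  escapes B (lattice_of (g *m P)) ->
  escapes B^T (dual_lattice (lattice_of (g *m P))) ->
  good_pair P (invmx g *m B *m g).
Proof.
move=> uP ug; have ugP : g *m P \in unitmx by rewrite unitmx_mul ug.
rewrite dual_lattice_of // invmxM // trmx_mul => e1 e2.
split; first exact: escapes_conj.
have -> : (invmx g *m B *m g)^T = invmx (invmx g)^T *m B^T *m (invmx g)^T.
  by rewrite trmx_inv invmxK -trmx_inv !trmx_mul mulmxA.
by apply: escapes_conj => //; rewrite unitmx_tr unitmx_inv.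
Qed.

Lemma fubini_sections (R : realType) d1 d2 (T1 : measurableType d1)
    (T2 : measurableType d2) (m1 : {sigma_finite_measure set T1 -> \bar R})
    (m2 : {sigma_finite_measure set T2 -> \bar R}) (A : set (T1 * T2)) :
  measurable A ->
  (\int[m1]_x m2 (xsection A x) = \int[m2]_y m1 (ysection A y))%E.
Proof.
move=> mA; have := indic_fubini_tonelli m1 m2 mA.
by rewrite indic_fubini_tonelli_FE // indic_fubini_tonelli_GE.
Qed.

(** For every B with |det B| > 1 and almost every g the conjugate g^-1 B g has
    the property, so the pairs (B, g) for which it fails form a null set. Slicing
    at fixed g and translating B by g, the pairs for which it fails at B g form a
    null set too, and the slices of that set at fixed B are translates of the
    exceptional set. *)
Lemma haar_ae_good_pair (R : realType) (n : nat) (P : 'M[R]_n.+1)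
    (nu : {sigma_finite_measure set (borel (GL R n)) -> \bar R}) :
  P \in unitmx -> haar_measure nu ->
  {ae nu, forall B : GL R n, 1 < `|\det (\val B)| -> good_pair P (\val B)}.
Proof.
move=> uP hnu; have [nu0 _ inv] := hnu.
pose v (g : borel (GL R n)) : 'M[R]_n.+1 := \val (g : GL R n).
have uv g : v g \in unitmx by exact: GL_unit.
have mv : entries_measurable v.
  move=> i j; apply: (@continuous_borel_measurable R (GL R n)).
  by apply: continuous_coord; exact: continuous_GL_val.
have miv : entries_measurable (fun g => invmx (v g)).
  move=> i j; apply: (@continuous_borel_measurable R (GL R n)).
  apply: continuous_coord; apply: continuous_invmx; first exact: continuous_GL_val.
  exact: GL_unit.
have mdet : measurable_fun [set: borel (GL R n)] (fun g : borel (GL R n) => `|\det (v g)|).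
  apply: (@continuous_borel_measurable R (GL R n)).
  by apply: continuous_normr; apply: continuous_det; exact: continuous_GL_val.
pose Z : set 'M[R]_n.+1 := [set B | 1 < `|\det B| /\ ~ good_pair P B].
have mZ d (X : measurableType d) (F : X -> 'M[R]_n.+1) : entries_measurable F ->
    measurable_fun [set: X] (fun x => `|\det (F x)|) ->
    measurable [set x | Z (F x)].
  move=> mF mdF; apply: measurableI.
    have := measurable_fun_ltr (measurable_cst (1 : R)) mdF.
    move=> /(_ measurableT [set true]); rewrite setTI; apply => //.
  by apply: measurableC; exact: measurable_good_pair.
have m1 : entries_measurable (fun p : borel (GL R n) * borel (GL R n) => v p.1).
  by move=> i j; exact: (measurableT_comp (mv i j) measurable_fst).
have m2 : entries_measurable (fun p : borel (GL R n) * borel (GL R n) => v p.2).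
  by move=> i j; exact: (measurableT_comp (mv i j) measurable_snd).
have mi2 : entries_measurable (fun p : borel (GL R n) * borel (GL R n) => invmx (v p.2)).
  by move=> i j; exact: (measurableT_comp (miv i j) measurable_snd).
have md1 : measurable_fun [set: borel (GL R n) * borel (GL R n)] (fun p => `|\det (v p.1)|).
  exact: (measurableT_comp mdet measurable_fst).
have md2 : measurable_fun [set: borel (GL R n) * borel (GL R n)] (fun p => `|\det (v p.2)|).
  exact: (measurableT_comp mdet measurable_snd).
have detJ (B g : 'M[R]_n.+1) : g \in unitmx -> \det (invmx g *m B *m g) = \det B.
  move=> ug; rewrite !det_mulmx det_inv mulrAC mulVf ?mul1r //.
  by rewrite -unitfE -unitmxE.
pose W1 := [set p : borel (GL R n) * borel (GL R n) | Z (invmx (v p.2) *m v p.1 *m v p.2)].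
pose W2 := [set p : borel (GL R n) * borel (GL R n) | Z (v p.1 *m v p.2)].
have mW1 : measurable W1.
  apply: mZ; first by do 2! apply: entries_measurable_mul => //.
  by under eq_fun do rewrite detJ ?uv //.
have mW2 : measurable W2.
  apply: mZ; first exact: entries_measurable_mul.
  by under eq_fun do rewrite det_mulmx normrM; exact: measurable_funM.
have W1x B : nu (xsection W1 B) = 0%E.
  have mx : measurable (xsection W1 B) by exact: measurable_xsection.
  have [dB|dB] := ltP 1 `|\det (v B)|; last first.
    rewrite (_ : xsection W1 B = set0) ?measure0 //.
    apply/seteqP; split=> // g /xsectionP [].
    by rewrite /= detJ ?uv // ltNge dB.
  apply/(negligibleP _ mx).
  apply: negligibleS (action_ae_escapes (GL_action uP hnu) (uv B) dB).
  by move=> g /xsectionP [_ ng] [e1 e2]; apply: ng; exact: good_pair_conj.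
have W12 g : nu (ysection W1 g) = nu (ysection W2 g).
  rewrite -(inv g); last exact: measurable_ysection.
  congr (nu _); apply/seteqP.
  have E B : invmx (v g) *m (v g *m v B) *m v g = v B *m v g by rewrite mulKmx.
  split=> B /=.
    by move=> /ysectionP; rewrite /W1 /= E => ?; apply/ysectionP.
  by move=> /ysectionP W2B; apply/ysectionP; rewrite /W1 /= E.
pose bad := [set B : borel (GL R n) | Z (v B)].
have mbad : measurable bad by apply: mZ.
have W2x B : nu (xsection W2 B) = nu bad.
  rewrite -(inv B _ mbad); congr (nu _); apply/seteqP.
  by split=> g; [move=> /xsectionP|move=> ?; apply/xsectionP].
suff nubad : nu bad = 0%E.
  by exists bad; split => // B /not_implyP [].
have : (\int[nu]_B nu (xsection W2 B) = 0)%E.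
  rewrite (fubini_sections nu nu mW2).
  under eq_integral do rewrite -W12.
  rewrite -(fubini_sections nu nu mW1).
  by under eq_integral do rewrite W1x; rewrite integral0.
under eq_integral do rewrite W2x.
rewrite integral_cst // => /eqP; rewrite mule_eq0 => /orP[/eqP//|].
by move=> /eqP nuT; rewrite nuT eqxx in nu0.
Qed.

Theorem corollary4p7 (R : realType) (n : nat) :
  (forall (mu : probability (borel (Ln R n)) R), SL_invariant mu ->
     forall B : 'M[R]_n.+1, B \in unitmx -> 1 < `|\det B| ->
     {ae mu, forall G : Ln R n, lattice_counting_estimate B (\val G)})
  /\
  (forall G : set 'cV[R]_n.+1, full_rank_lattice G ->
     forall nu : {measure set (borel (GL R n)) -> \bar R}, haar_measure nu ->
     {ae nu, forall B : GL R n, 1 < `|\det (\val B)| ->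
        lattice_counting_estimate (\val B) G}).
Proof.
split=> [mu inv B uB dB|G [P uP ->] nu hnu].
  apply: filterS (action_ae_escapes (Ln_action inv) uB dB).
  move=> G [] /=; have [P [uP -> _]] : unimodular_lattice (\val G).
    by exact: (set_mem (valP G)).
  by rewrite dual_lattice_of // => e1 e2; exact: counting_of_escapes.
(* Fubini's theorem asks for a sigma-finite measure. *)
have sf : sigma_finite setT nu.
  exists (GL_bounded P).
    by apply/seteqP; split=> // g _; have [M gM] := GL_bounded_cover P g; exists M.
  move=> M; split; last exact: haar_bounded_finite.
  exact: (open_measurable_borel (GL_bounded_open M uP)).
pose sfin := isSFinite.Build _ _ _ (Measure.sort nu) (sfinite_measure_sigma_finite sf).
pose sigf := isSigmaFinite.Build _ _ _ (Measure.sort nu) sf.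
pose nu' := HB.pack_for {sigma_finite_measure set (borel (GL R n)) -> \bar R}
  (Measure.sort nu) sfin sigf.
apply: (negligibleS _ (@haar_ae_good_pair R n P nu' uP hnu)) => B /=.
apply: contra_not => gB dB; have [e1 e2] := gB dB.
by apply: counting_of_escapes => //; exact: GL_unit.
Qed.
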